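(* Let $\beta\in\mathbb N_0$, $\epsilon\in(0,2)$ and $c>0$. Then for all $x\in[-1+\epsilon,1]$ and all $\alpha,n\in\mathbb N_0$ with $1\le\alpha\le c(1+n)$, \[ \left|\left(\frac{1-x}{2}\right)^{\alpha/2}P_n^{(\alpha,\beta)}(x)\right|\le C_{\beta,c,\epsilon}\begin{cases}(u^2|x-x_{tr}|+\alpha^{4/3})^{-1/4}&\text{in any case},\\ 2^{-\alpha}&\text{if } 1-x\le\tfrac1{16}(1-x_{tr}),\end{cases} \] where $u=n+\frac{\alpha+\beta+1}{2}$, $x_{tr}=1-\frac{\alpha^2}{2u^2}$, and $C_{\beta,c,\epsilon}$ depends only on $\beta,c,\epsilon$.
   Context: $P_n^{(\alpha,\beta)}$ denotes the Jacobi polynomial of degree $n$ and parameters $(\alpha,\beta)$. *)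

(* Defs.v *)
From Stdlib Require Import Reals Lra.
Open Scope R_scope.

(* Jacobi polynomial P_n^{(a,b)}(x) for integer parameters a, b >= 0, via the
   classical explicit formula
   P_n^{(a,b)}(x) = sum_{s=0}^n binom(n+a, n-s) binom(n+b, s) ((x-1)/2)^s ((x+1)/2)^(n-s). *)
Definition jacobiP (n a b : nat) (x : R) : R :=
  sum_f_R0 (fun s => C (n + a) (n - s) * C (n + b) s
                     * ((x - 1) / 2) ^ s * ((x + 1) / 2) ^ (n - s)) n.

Definition jac_u (n a b : nat) : R := INR n + (INR a + INR b + 1) / 2.

Definition jac_xtr (n a b : nat) : R := 1 - INR a ^ 2 / (2 * jac_u n a b ^ 2).

(* ((1-x)/2)^(a/2), for x <= 1, written as sqrt((1-x)/2)^a *)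
Definition jac_weight (a : nat) (x : R) : R := sqrt ((1 - x) / 2) ^ a.

(* Main.v *)
(** With [y = (1 - x) / 2], [f = y ^ (a / 2) (1 - y) ^ (b / 2) P_n(1 - 2 y)] and
    [D = y (1 - y) d/dy], the Jacobi equation becomes [D (D f) = - q f] for a quadratic
    polynomial [q] with a turning point next to [t = (1 - x_tr) / 2].  The ladder relations
    between [P_(n+1)^(a,b)] and [P_n^(a+1,b+1)] give [2 u * int_0^1 f ^ 2 <= 1], hence
    [(D f) ^ 2 + q f ^ 2 = O(u)] at one point and then, by Gronwall, on compact sets away from
    the turning point.  This bound is carried towards the turning point by
    [p ((D f) ^ 2 + q f ^ 2) - (D p) f (D f) + (D (D p)) f ^ 2 / 2] with
    [p = (q + ka) ^ (- 1 / 2)], which is monotone as soon as [ka] is a large multiple of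
    [a ^ (4 / 3)]; a Gronwall argument crosses the Airy zone, and beyond the turning point
    [(D f) ^ 2 + q f ^ 2 >= 0] forces [D f >= sqrt (- q) f], that is, decay.  Bounded [u] leaves
    only finitely many pairs [(n, a)]. *)
Require Import Defs.
From Stdlib Require Import Reals ZArith Factorial Lra Lia.
From Coquelicot Require Import Coquelicot.
Open Scope R_scope.

(** All constants must be uniform in [n] and [a], so the scales decide everything. The hypothesis
    [a <= c * (1 + n)] gives [t <= 1 - l] with [l > 0] depending on [c] only: the turning point
    stays away from [y = 1]. Near it [D q] has the size of [u ^ 2 * t], that is of [z ^ 3] with
    [z = a ^ (2 / 3)]; an Airy equation with this slope has length scale [1 / z], and [q] has size
    [z ^ 2 = a ^ (4 / 3)] there. A Gronwall argument with rate of order [z] therefore loses only a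
    bounded factor across that zone.

    The obstacle lies between the Airy zone and the region where [q] is of order [u ^ 2]. There the
    plain energy [(D f) ^ 2 + q f ^ 2] is monotone, but this gives only [f ^ 2 = O(u / q)], whereas
    the theorem asks for [O(q ^ (- 1 / 2))]. The functional with [p] has this sharper size, and the
    shift by [ka] keeps [p] regular where [q] vanishes. *)

Ltac eqR := match goal with |- @eq _ ?x ?y => change (@eq R x y) end.

Lemma is_derive_mulR (f g : R -> R) (y df dg d : R) :
  is_derive f y df -> is_derive g y dg -> df * g y + f y * dg = d ->
  is_derive (fun z => f z * g z) y d.
Proof.
  intros Hf Hg <-. apply (is_derive_mult f g y df dg Hf Hg Rmult_comm).
Qed.

(** [C] is the type of complex numbers in Coquelicot, and below it also names the function
    [(D f) ^ 2]. *)
Notation binom := Stdlib.Reals.Binomial.C.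

(** * Jacobi polynomials on [[0, 1]] and their ladder relations *)

Definition jac01 (n a b : nat) (y : R) : R :=
  sum_f_R0 (fun s => binom (n + a) (n - s) * binom (n + b) s
                     * (- y) ^ s * (1 - y) ^ (n - s)) n.

Lemma jacobiP_jac01 (n a b : nat) (x : R) :
  jacobiP n a b x = jac01 n a b ((1 - x) / 2).
Proof.
  unfold jacobiP, jac01. apply sum_eq. intros s _.
  replace ((x - 1) / 2) with (- ((1 - x) / 2)) by field.
  replace ((x + 1) / 2) with (1 - (1 - x) / 2) by field.
  reflexivity.
Qed.

Lemma binom_succ_r (m k : nat) :
  (k < m)%nat -> INR (m - k) * binom m k = INR (S k) * binom m (S k).
Proof.
  intros H. unfold binom.
  replace (m - k)%nat with (S (m - S k)) by lia.
  rewrite (fact_simpl (m - S k)), (fact_simpl k), !mult_INR.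
  pose proof (INR_fact_neq_0 k). pose proof (INR_fact_neq_0 (m - S k)).
  pose proof (not_0_INR (S k) ltac:(lia)). pose proof (not_0_INR (S (m - S k)) ltac:(lia)).
  field. auto.
Qed.

Lemma is_derive_sum_f_R0 (f f' : nat -> R -> R) (n : nat) (y : R) :
  (forall s, (s <= n)%nat -> is_derive (f s) y (f' s y)) ->
  is_derive (fun z => sum_f_R0 (fun s => f s z) n) y (sum_f_R0 (fun s => f' s y) n).
Proof.
  induction n as [|n IH]; intros H; simpl.
  - apply H. lia.
  - apply @is_derive_plus.
    + apply IH. intros s Hs. apply H. lia.
    + apply H. lia.
Qed.

(** Differentiating the [s]-th term of a form of degree [n + 1] in [- y] and [1 - y] produces
    monomials of index [s] and [s - 1]; this regroups them into two sums of degree [n]. *)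
Lemma sum_shift_top (f g h : nat -> R) (n : nat) :
  f 0%nat = g 0%nat -> (forall s, (s < n)%nat -> f (S s) = g (S s) + h s) ->
  f (S n) = h n ->
  sum_f_R0 f (S n) = sum_f_R0 g n + sum_f_R0 h n.
Proof.
  intros H0 HS Ht.
  (* At every stage [h m] is the one term still waiting for its partner [f (S m)]. *)
  assert (E : forall m, (m <= n)%nat ->
    sum_f_R0 f m + h m = sum_f_R0 g m + sum_f_R0 h m).
  { induction m as [|m IH]; intros Hm; simpl.
    - rewrite H0. ring.
    - specialize (IH ltac:(lia)). rewrite (HS m) by lia. lra. }
  rewrite tech5, Ht. apply E. lia.
Qed.

(** By [binom_succ_r] both summands are multiples of the product on the right, with factors
    [n + 1 + b - s] and [a + 1 + s], whose sum does not depend on [s]. *)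
Lemma jac01_coef_sum (n a b s : nat) :
  (s <= n)%nat ->
  INR (S s) * (binom (S n + a) (S n - S s) * binom (S n + b) (S s))
  + INR (S n - s) * (binom (S n + a) (S n - s) * binom (S n + b) s)
  = INR (n + a + b + 2) * (binom (n + S a) (n - s) * binom (n + S b) s).
Proof.
  intros H.
  replace (n + S a)%nat with (S n + a)%nat by lia.
  replace (n + S b)%nat with (S n + b)%nat by lia.
  pose proof (binom_succ_r (S n + a) (n - s) ltac:(lia)) as E1.
  pose proof (binom_succ_r (S n + b) s ltac:(lia)) as E2.
  replace (S n - S s)%nat with (n - s)%nat by lia.
  replace (S n - s)%nat with (S (n - s)) by lia.
  replace (INR (S s) * (binom (S n + a) (n - s) * binom (S n + b) (S s)))
    with (binom (S n + a) (n - s) * (INR (S s) * binom (S n + b) (S s))) by ring.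
  rewrite <- E2.
  rewrite <- (Rmult_assoc (INR (S (n - s)))), <- E1.
  replace (n + a + b + 2)%nat with ((S n + a - (n - s)) + (S n + b - s))%nat by lia.
  rewrite plus_INR. ring.
Qed.

Lemma is_derive_monomial (c : R) (j k : nat) (y : R) :
  is_derive (fun z => c * (- z) ^ j * (1 - z) ^ k) y
    (c * (- INR j * (- y) ^ pred j * (1 - y) ^ k
          - (- y) ^ j * (INR k * (1 - y) ^ pred k))).
Proof. auto_derive; [easy|]. change (1 + - y) with (1 - y). ring. Qed.

Lemma is_derive_weight (c : R) (j k : nat) (y : R) :
  is_derive (fun z => c * z ^ j * (1 - z) ^ k) y
    (c * (INR j * y ^ pred j * (1 - y) ^ k - y ^ j * (INR k * (1 - y) ^ pred k))).
Proof. auto_derive; [easy|]. change (1 + - y) with (1 - y). ring. Qed.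

Lemma is_derive_weighted_monomial (c : R) (a b j k : nat) (y : R) :
  is_derive (fun z => c * z ^ S a * (1 - z) ^ S b * ((- z) ^ j * (1 - z) ^ k)) y
    (y ^ a * (1 - y) ^ b * c *
     (INR (a + 1 + j) * ((- y) ^ j * (1 - y) ^ S k)
      + INR (b + 1 + k) * ((- y) ^ S j * (1 - y) ^ k))).
Proof.
  replace (a + 1 + j)%nat with (S a + j)%nat by lia.
  replace (b + 1 + k)%nat with (S b + k)%nat by lia.
  rewrite !plus_INR.
  (* Truncated [pred] does no harm: at exponent [0] the factor [INR 0] removes the term. *)
  assert (P1 : INR j * (- y) ^ pred j * - y = INR j * (- y) ^ j).
  { destruct j; simpl pred; simpl pow; simpl INR; ring. }
  assert (P2 : INR k * (1 - y) ^ pred k * (1 - y) = INR k * (1 - y) ^ k).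
  { destruct k; simpl pred; simpl pow; simpl INR; ring. }
  apply (is_derive_ext (fun z => c * z ^ S a * (1 - z) ^ S b * (1 * (- z) ^ j * (1 - z) ^ k))).
  { intros z. eqR. ring. }
  eapply is_derive_mulR;
    [apply (is_derive_weight c (S a) (S b)) | apply is_derive_monomial |].
  simpl pred.
  transitivity (y ^ a * (1 - y) ^ b * c * (INR (S a) * (- y) ^ j * (1 - y) ^ (S k)
        + INR (S b) * ((- y) ^ S j * (1 - y) ^ k)
        + (INR j * (- y) ^ pred j * - y) * (1 - y) ^ k * (1 - y)
        + (INR k * (1 - y) ^ pred k * (1 - y)) * (- y) ^ S j)).
  - rewrite <- !tech_pow_Rmult. ring.
  - rewrite P1, P2, <- !tech_pow_Rmult. ring.
Qed.

Lemma jac01_derive (n a b : nat) (y : R) :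
  is_derive (jac01 (S n) a b) y (- INR (n + a + b + 2) * jac01 n (S a) (S b) y).
Proof.
  set (c s := binom (S n + a) (S n - s) * binom (S n + b) s).
  evar_last.
  - apply (is_derive_sum_f_R0
      (fun s z => binom (S n + a) (S n - s) * binom (S n + b) s * (- z) ^ s * (1 - z) ^ (S n - s))
      (fun s z => c s * (- INR s * (- z) ^ pred s * (1 - z) ^ (S n - s)
                  - (- z) ^ s * (INR (S n - s) * (1 - z) ^ pred (S n - s))))).
    intros s Hs. apply is_derive_monomial.
  - unfold jac01.
    rewrite scal_sum.
    rewrite (sum_shift_top _
      (fun s => - c s * INR (S n - s) * (- y) ^ s * (1 - y) ^ (n - s))
      (fun s => - c (S s) * INR (S s) * (- y) ^ s * (1 - y) ^ (n - s))).
    + rewrite <- sum_plus. apply sum_eq. intros s Hs.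
      pose proof (jac01_coef_sum n a b s Hs) as E. unfold c.
      transitivity (- (- y) ^ s * (1 - y) ^ (n - s) *
         (INR (S s) * (binom (S n + a) (S n - S s) * binom (S n + b) (S s))
  + INR (S n - s) * (binom (S n + a) (S n - s) * binom (S n + b) s))); [ring|].
      rewrite E. ring.
    + replace (pred (S n - 0)) with (n - 0)%nat by lia. simpl INR at 1. ring.
    + intros s Hs. replace (S n - S s)%nat with (n - s)%nat by lia.
      replace (pred (S s)) with s by lia.
      replace (pred (n - s)) with (n - S s)%nat by lia. ring.
    + replace (S n - S n)%nat with 0%nat by lia.
      replace (n - n)%nat with 0%nat by lia. simpl pred. simpl INR at 2. ring.
Qed.

(** Adjoint of [jac01_derive] for the Jacobi weights. Composing the two relations gives the Jacobi
    equation; pairing them in an integral gives a recursion for the norms. *)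
Lemma jac01_weighted_derive (n a b : nat) (y : R) :
  is_derive (fun z => z ^ S a * (1 - z) ^ S b * jac01 n (S a) (S b) z) y
    (INR (S n) * (y ^ a * (1 - y) ^ b * jac01 (S n) a b y)).
Proof.
  set (e s := binom (n + S a) (n - s) * binom (n + S b) s).
  apply (is_derive_ext
    (fun z => sum_f_R0 (fun s => e s * z ^ (S a) * (1 - z) ^ (S b) * ((- z) ^ s * (1 - z) ^ (n - s))) n)).
  { intros z. unfold jac01. rewrite scal_sum. apply sum_eq. intros s _. unfold e. ring. }
  evar_last.
  - apply (is_derive_sum_f_R0
      (fun s z => e s * z ^ (S a) * (1 - z) ^ (S b) * ((- z) ^ s * (1 - z) ^ (n - s)))
      (fun s z => z ^ a * (1 - z) ^ b * e s *
         (INR (a + 1 + s) * ((- z) ^ s * (1 - z) ^ (S n - s))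
          + INR (b + 1 + n - s) * ((- z) ^ S s * (1 - z) ^ (S n - S s))))).
    intros s Hs.
    replace (S n - s)%nat with (S (n - s)) by lia.
    replace (S n - S s)%nat with (n - s)%nat by lia.
    replace (b + 1 + n - s)%nat with (b + 1 + (n - s))%nat by lia.
    apply is_derive_weighted_monomial.
  - rewrite <- Rmult_assoc. unfold jac01. rewrite scal_sum.
    symmetry.
    rewrite (sum_shift_top _
      (fun s => y ^ a * (1 - y) ^ b * e s * (INR (a + 1 + s) * ((- y) ^ s * (1 - y) ^ (S n - s))))
      (fun s => y ^ a * (1 - y) ^ b * e s * (INR (b + 1 + n - s) * ((- y) ^ S s * (1 - y) ^ (S n - S s))))).
    + rewrite <- sum_plus. apply sum_eq. intros s Hs. ring.
    + unfold e. replace (n + S a)%nat with (S n + a)%nat by lia.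
      replace (n + S b)%nat with (S n + b)%nat by lia.
      pose proof (binom_succ_r (S n + a) n ltac:(lia)) as E1.
      replace (S n + a - n)%nat with (a + 1 + 0)%nat in E1 by lia.
      replace (n - 0)%nat with n by lia. replace (S n - 0)%nat with (S n) by lia.
      transitivity (y ^ a * (1 - y) ^ b * binom (S n + b) 0 * (- y) ^ 0 * (1 - y) ^ S n
        * (INR (S n) * binom (S n + a) (S n))); [ring|].
      rewrite <- E1. ring.
    + intros s Hs. unfold e. replace (n + S a)%nat with (S n + a)%nat by lia.
      replace (n + S b)%nat with (S n + b)%nat by lia.
      pose proof (binom_succ_r (S n + a) (n - S s) ltac:(lia)) as E1.
      pose proof (binom_succ_r (S n + b) s ltac:(lia)) as E2.
      replace (S n + a - (n - S s))%nat with (a + 1 + S s)%nat in E1 by lia.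
      replace (S n + b - s)%nat with (b + 1 + n - s)%nat in E2 by lia.
      replace (S (n - S s)) with (n - s)%nat in E1 by lia.
      replace (S n - S s)%nat with (n - s)%nat by lia.
      set (Y := (- y) ^ S s * (1 - y) ^ (n - s)).
      (* The factor [n + 1] is split as [(n - s) + (s + 1)], one part to be absorbed by each
         binomial coefficient. *)
      replace (INR (S n)) with (INR (n - s) + INR (S s)) by (rewrite <- plus_INR; f_equal; lia).
      transitivity (y ^ a * (1 - y) ^ b * Y * (
         (INR (n - s) * binom (S n + a) (n - s)) * binom (S n + b) (S s)
         + binom (S n + a) (n - s) * (INR (S s) * binom (S n + b) (S s)))); [unfold Y; ring|].
      rewrite <- E1, <- E2. unfold Y. ring.
    + unfold e. replace (n + S a)%nat with (S n + a)%nat by lia.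
      replace (n + S b)%nat with (S n + b)%nat by lia.
      pose proof (binom_succ_r (S n + b) n ltac:(lia)) as E2.
      replace (S n + b - n)%nat with (b + 1 + n - n)%nat in E2 by lia.
      replace (n - n)%nat with 0%nat by lia.
      replace (S n - S n)%nat with 0%nat by lia.
      transitivity (y ^ a * (1 - y) ^ b * binom (S n + a) 0 * (- y) ^ S n * (1 - y) ^ 0
        * (INR (S n) * binom (S n + b) (S n))); [ring|].
      rewrite <- E2. ring.
Qed.

Lemma ex_derive_jac01 (n a b : nat) (y : R) : ex_derive (jac01 n a b) y.
Proof.
  destruct n as [|n].
  - apply (ex_derive_ext (fun _ => jac01 0 a b 0)).
    + intros z. unfold jac01. simpl. reflexivity.
    + apply ex_derive_const.
  - eexists. apply jac01_derive.
Qed.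

(** * Weighted [L^2] norm of the Jacobi polynomials *)

Lemma ex_RInt_of_ex_derive (f : R -> R) (a b : R) :
  (forall y, ex_derive f y) -> ex_RInt f a b.
Proof.
  intros H. apply (ex_RInt_continuous (V := R_CompleteNormedModule)).
  intros z _. apply (ex_derive_continuous f). apply H.
Qed.

Lemma RInt_of_derive (f f' : R -> R) (a b : R) :
  (forall y, is_derive f y (f' y)) -> (forall y, ex_derive f' y) ->
  RInt f' a b = f b - f a.
Proof.
  intros Hf Hf'. apply is_RInt_unique.
  apply (is_RInt_derive f f').
  - intros y _. apply Hf.
  - intros y _. apply (ex_derive_continuous f'). apply Hf'.
Qed.

Lemma RInt_lin_comb (c d : R) (f g : R -> R) (a b : R) :
  (forall y, ex_derive f y) -> (forall y, ex_derive g y) ->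
  RInt (fun y => c * f y - d * g y) a b = c * RInt f a b - d * RInt g a b.
Proof.
  intros Hf Hg.
  apply ex_RInt_of_ex_derive with (a := a) (b := b) in Hf, Hg.
  pose proof (RInt_correct (V := R_CompleteNormedModule) f a b Hf) as If.
  pose proof (RInt_correct (V := R_CompleteNormedModule) g a b Hg) as Ig.
  apply is_RInt_unique.
  apply (is_RInt_minus (fun y => c * f y) (fun y => d * g y) a b (c * RInt f a b) (d * RInt g a b)).
  - apply (is_RInt_scal f a b c _ If).
  - apply (is_RInt_scal g a b d _ Ig).
Qed.

Lemma ex_derive_beta (a b : nat) (y : R) : ex_derive (fun z => z ^ a * (1 - z) ^ b) y.
Proof. auto_derive. easy. Qed.

Lemma RInt_beta (a b : nat) :
  INR (a + b + 1) * RInt (fun y => y ^ a * (1 - y) ^ b) 0 1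
  = INR (fact a) * INR (fact b) / INR (fact (a + b)).
Proof.
  revert a. induction b as [|b IH]; intros a.
  - replace (a + 0 + 1)%nat with (S a) by lia. replace (a + 0)%nat with a by lia.
    rewrite (RInt_of_derive (fun y => / INR (S a) * y ^ S a * (1 - y) ^ 0)).
    + simpl fact. rewrite pow1, pow_i by lia. simpl (_ ^ 0). 
      pose proof (not_0_INR (S a) ltac:(lia)). pose proof (INR_fact_neq_0 a).
      simpl (INR 1). field. auto.
    + intros y. evar_last; [apply is_derive_weight|].
      pose proof (not_0_INR (S a) ltac:(lia)).
      simpl pred. simpl (INR 0). eqR. field. auto.
    + apply ex_derive_beta.
  (* Integration by parts: the integrand is the derivative of [y ^ (a + 1) * (1 - y) ^ (b + 1)],
     which vanishes at both ends. It trades a power of [1 - y] for a power of [y]. *)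
  - assert (E : INR (S a) * RInt (fun y => y ^ a * (1 - y) ^ S b) 0 1
                - INR (S b) * RInt (fun y => y ^ S a * (1 - y) ^ b) 0 1 = 0).
    { rewrite <- RInt_lin_comb; [|apply ex_derive_beta|apply ex_derive_beta].
      rewrite (RInt_of_derive (fun y => 1 * y ^ S a * (1 - y) ^ S b)).
      - rewrite Rminus_diag, Rminus_0_r, !pow1, !pow_i by lia. ring.
      - intros y. evar_last; [apply is_derive_weight|]. simpl pred. eqR. ring.
      - intros y. auto_derive. easy. }
    specialize (IH (S a)).
    replace (S a + b + 1)%nat with (S (S (a + b))) in IH by lia.
    replace (S a + b)%nat with (S (a + b)) in IH by lia.
    replace (a + S b + 1)%nat with (S (S (a + b))) by lia.
    replace (a + S b)%nat with (S (a + b)) by lia.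
    set (X := RInt (fun y => y ^ a * (1 - y) ^ S b) 0 1) in *.
    set (Y := RInt (fun y => y ^ S a * (1 - y) ^ b) 0 1) in *.
    pose proof (not_0_INR (S a) ltac:(lia)) as Ha.
    pose proof (INR_fact_neq_0 (S (a + b))) as Hab.
    rewrite (fact_simpl a), mult_INR in IH. rewrite (fact_simpl b), mult_INR.
    assert (EX : X = INR (S b) * Y / INR (S a)).
    { apply (Rmult_eq_reg_l (INR (S a))); [|exact Ha]. field_simplify; [lra|exact Ha]. }
    rewrite EX.
    transitivity (INR (S b) / INR (S a) * (INR (S (S (a + b))) * Y)).
    + field. exact Ha.
    + rewrite IH. field. auto.
Qed.

Definition jac_density (n a b : nat) (y : R) : R := y ^ a * (1 - y) ^ b * jac01 n a b y ^ 2.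

Lemma ex_derive_jac_density (n a b : nat) (y : R) : ex_derive (jac_density n a b) y.
Proof.
  unfold jac_density.
  apply (ex_derive_mult (fun z => z ^ a * (1 - z) ^ b) (fun z => jac01 n a b z ^ 2)).
  - apply ex_derive_beta.
  - apply (ex_derive_pow (jac01 n a b)). apply ex_derive_jac01.
Qed.

(** The ladder relations reduce [(n + 1, a, b)] to [(n, a + 1, b + 1)] and end at a beta integral.
    The factor [2 n + a + b + 1] is invariant under this move, which is why the induction on [n]
    must quantify over [a] and [b]. *)
Lemma RInt_jac_density (n a b : nat) :
  INR (2 * n + a + b + 1) * RInt (jac_density n a b) 0 1
  = INR (fact (n + a)) * INR (fact (n + b)) / (INR (fact n) * INR (fact (n + a + b))).
Proof.
  revert a b. induction n as [|n IH]; intros a b.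
  - simpl (2 * 0 + a + b + 1)%nat. simpl (0 + _)%nat.
    rewrite (RInt_ext _ (fun y => y ^ a * (1 - y) ^ b)).
    + rewrite RInt_beta. simpl (INR (fact 0)). field. apply INR_fact_neq_0.
    + intros y _. unfold jac_density, jac01. simpl sum_f_R0. unfold binom.
      replace (a - 0)%nat with a by lia. replace (b - 0)%nat with b by lia. simpl (fact 0).
      simpl (INR 1). eqR.
      field. split; apply INR_fact_neq_0.
  - assert (E : INR (S n) * RInt (jac_density (S n) a b) 0 1
                - INR (n + a + b + 2) * RInt (jac_density n (S a) (S b)) 0 1 = 0).
    { rewrite <- RInt_lin_comb; [|apply ex_derive_jac_density..].
      rewrite (RInt_of_derive (fun y => y ^ S a * (1 - y) ^ S b * jac01 n (S a) (S b) y
                                        * jac01 (S n) a b y)).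
      - rewrite Rminus_diag, Rminus_0_r, !pow1, !pow_i by lia. ring.
      - intros y. eapply is_derive_mulR;
          [apply jac01_weighted_derive|apply jac01_derive|].
        unfold jac_density. ring.
      - intros y. 
        apply (ex_derive_minus (fun y => INR (S n) * jac_density (S n) a b y)
                 (fun y => INR (n + a + b + 2) * jac_density n (S a) (S b) y));
        apply ex_derive_scal; apply ex_derive_jac_density. }
    specialize (IH (S a) (S b)).
    replace (2 * n + S a + S b + 1)%nat with (2 * S n + a + b + 1)%nat in IH by lia.
    replace (n + S a + S b)%nat with (S (S n + a + b)) in IH by lia.
    replace (n + S a)%nat with (S n + a)%nat in IH by lia.
    replace (n + S b)%nat with (S n + b)%nat in IH by lia.
    replace (n + a + b + 2)%nat with (S (S n + a + b)) in E by lia.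
    set (X := RInt (jac_density (S n) a b) 0 1) in *.
    set (Y := RInt (jac_density n (S a) (S b)) 0 1) in *.
    pose proof (not_0_INR (S n) ltac:(lia)) as Hn.
    pose proof (INR_fact_neq_0 n). pose proof (INR_fact_neq_0 (S n + a + b)).
    pose proof (not_0_INR (S (S n + a + b)) ltac:(lia)) as Hl.
    rewrite (fact_simpl (S n + a + b)), mult_INR in IH. rewrite (fact_simpl n), mult_INR.
    assert (EX : X = INR (S (S n + a + b)) * Y / INR (S n)).
    { apply (Rmult_eq_reg_l (INR (S n))); [|exact Hn]. field_simplify; [lra|exact Hn]. }
    rewrite EX.
    transitivity (INR (S (S n + a + b)) / INR (S n) * (INR (2 * S n + a + b + 1) * Y)).
    + field. exact Hn.
    + rewrite IH. field. repeat split; auto.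
Qed.

(** Raising [b] by one multiplies the two sides by [n + b + 1] and [n + a + b + 1]. *)
Lemma fact_ratio_le (n a b : nat) :
  INR (fact (n + a)) * INR (fact (n + b)) <= INR (fact n) * INR (fact (n + a + b)).
Proof.
  rewrite <- !mult_INR. apply le_INR.
  induction b as [|b IH].
  - replace (n + 0)%nat with n by lia. replace (n + a + 0)%nat with (n + a)%nat by lia. lia.
  - replace (n + S b)%nat with (S (n + b)) by lia.
    replace (n + a + S b)%nat with (S (n + a + b)) by lia.
    rewrite (fact_simpl (n + b)), (fact_simpl (n + a + b)). nia.
Qed.

Lemma RInt_jac_density_le (n a b : nat) :
  INR (2 * n + a + b + 1) * RInt (jac_density n a b) 0 1 <= 1.
Proof.
  rewrite RInt_jac_density.
  pose proof (INR_fact_lt_0 n). pose proof (INR_fact_lt_0 (n + a + b)).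
  apply Rle_div_l; [nra|]. rewrite Rmult_1_l. apply fact_ratio_le.
Qed.

(** * The differential equation and its form for [f ^ 2], [f * D f], [(D f) ^ 2] *)

Lemma jac01_ode (n a b : nat) :
  exists P1 P2 : R -> R,
    (forall y, is_derive (jac01 n a b) y (P1 y)) /\
    (forall y, is_derive P1 y (P2 y)) /\
    (forall y, 0 < y < 1 ->
      y * (1 - y) * P2 y + (INR a + 1 - (INR a + INR b + 2) * y) * P1 y
      + INR n * (INR n + INR a + INR b + 1) * jac01 n a b y = 0).
Proof.
  destruct n as [|n].
  - exists (fun _ => 0), (fun _ => 0). split; [|split].
    + intros y. apply (is_derive_ext (fun _ => jac01 0 a b 0)).
      * intros z. unfold jac01. simpl. reflexivity.
      * apply @is_derive_const.
    + intros y. apply @is_derive_const.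
    + intros y _. simpl. ring.
  - set (la := INR (n + a + b + 2)).
    set (Q := jac01 n (S a) (S b)).
    assert (HQ : forall y, is_derive Q y (Derive Q y)).
    { intros y. apply Derive_correct, ex_derive_jac01. }
    exists (fun y => - la * Q y), (fun y => - la * Derive Q y).
    split; [|split].
    + intros y. apply jac01_derive.
    + intros y. apply is_derive_scal. apply HQ.
    + intros y Hy.
      (* The same weighted function is differentiated twice over, by the ladder relation and by the
         product rule; comparing both and cancelling the weight gives the equation, hence the
         restriction to [0 < y < 1]. *)
      pose proof (jac01_weighted_derive n a b y) as H1.
      assert (H2 : is_derive (fun z => 1 * z ^ S a * (1 - z) ^ S b * Q z) y
        (1 * (INR (S a) * y ^ a * (1 - y) ^ S b - y ^ S a * (INR (S b) * (1 - y) ^ b)) * Q y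
         + 1 * y ^ S a * (1 - y) ^ S b * Derive Q y)).
      { eapply is_derive_mulR; [apply is_derive_weight|apply HQ|reflexivity]. }
      apply (is_derive_ext _ (fun z => z ^ S a * (1 - z) ^ S b * Q z)) in H2.
      2:{ intros z. eqR. ring. }
      apply is_derive_unique in H1. apply is_derive_unique in H2.
      unfold Q in H2 at 1. rewrite H1 in H2. clear H1.
      assert (Hw : y ^ a * (1 - y) ^ b <> 0).
      { apply Rmult_integral_contrapositive_currified; apply pow_nonzero; lra. }
      apply (Rmult_eq_reg_l (y ^ a * (1 - y) ^ b)); [|exact Hw].
      rewrite Rmult_0_r.
      assert (El : la = INR (S n) + INR a + INR b + 1).
      { unfold la. rewrite !plus_INR, (S_INR n). simpl (INR 2). ring. }
      assert (H3 : la * (INR (S n) * (y ^ a * (1 - y) ^ b * jac01 (S n) a b y)) =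
        la * (y ^ a * (1 - y) ^ b * (((INR a + 1) * (1 - y) - (INR b + 1) * y) * Q y + y * (1 - y) * Derive Q y))).
      { f_equal. eqR. rewrite H2. rewrite !S_INR, <- !tech_pow_Rmult. ring. }
      rewrite <- El. 
      transitivity (la * (INR (S n) * (y ^ a * (1 - y) ^ b * jac01 (S n) a b y)) -
        la * (y ^ a * (1 - y) ^ b * (((INR a + 1) * (1 - y) - (INR b + 1) * y) * Q y + y * (1 - y) * Derive Q y))).
      * ring.
      * rewrite H3. ring.
Qed.

Definition qpot (u t b y : R) : R :=
  u ^ 2 * (1 - y) * (y - t) - y * (1 - y) / 4 - b ^ 2 * y / 4.

(** With [D = y (1 - y) d/dy], the equation [D (D f) = - qpot * f] is encoded through the
    polynomial functions [A = f ^ 2], [B = f * D f] and [C = (D f) ^ 2]. *)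
Record osc_triple (u t b : R) (A B C : R -> R) : Prop := {
  osc_A : forall y, 0 < y < 1 -> is_derive A y (2 * B y / (y * (1 - y)));
  osc_B : forall y, 0 < y < 1 ->
    is_derive B y ((C y - qpot u t b y * A y) / (y * (1 - y)));
  osc_C : forall y, 0 < y < 1 ->
    is_derive C y (- 2 * qpot u t b y * B y / (y * (1 - y)));
  osc_A_cont : forall y, continuity_pt A y;
  osc_B_cont : forall y, continuity_pt B y;
  osc_C_cont : forall y, continuity_pt C y;
  osc_A_ge0 : forall y, 0 <= y <= 1 -> 0 <= A y;
  osc_C_ge0 : forall y, 0 <= y <= 1 -> 0 <= C y;
  osc_disc : forall y, B y ^ 2 = A y * C y;
  osc_A0 : A 0 = 0;
  osc_B0 : B 0 = 0;
  osc_C0 : C 0 = 0;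
  osc_norm : RInt A 0 1 <= / (2 * u)
}.

Lemma jac_u_pos (n a b : nat) : 0 < jac_u n a b.
Proof. unfold jac_u. pose proof (pos_INR n). pose proof (pos_INR a). pose proof (pos_INR b). lra. Qed.

Lemma continuity_pt_of_ex_derive (f : R -> R) (y : R) : ex_derive f y -> continuity_pt f y.
Proof.
  intros H. apply continuity_pt_filterlim. apply (ex_derive_continuous f y H).
Qed.

(** Formally [f = W ^ (1 / 2) * P] and [D f = W ^ (1 / 2) * S], where [s = D W / (2 W)] comes from
    differentiating the root of the weight. In the three products the half powers combine to [W], so
    neither roots nor the sign of [f] have to be handled. The values at [0] vanish because
    [1 <= a]. *)
Lemma jac_osc_triple (n a b : nat) : (1 <= a)%nat ->
  exists B C, osc_triple (jac_u n a b) (INR a ^ 2 / (4 * jac_u n a b ^ 2)) (INR b)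
                (jac_density n a b) B C.
Proof.
  intros Ha.
  destruct (jac01_ode n a b) as (P1 & P2 & HP & HP1 & Hode).
  set (P := jac01 n a b) in *.
  set (W := fun y => y ^ a * (1 - y) ^ b).
  set (s := fun y => (INR a * (1 - y) - INR b * y) / 2).
  set (S := fun y => s y * P y + y * (1 - y) * P1 y).
  set (q := qpot (jac_u n a b) (INR a ^ 2 / (4 * jac_u n a b ^ 2)) (INR b)).
  pose proof (jac_u_pos n a b) as Hu.
  assert (HA : forall y, jac_density n a b y = W y * P y * P y).
  { intros y. unfold jac_density, W, P. ring. }
  assert (DW : forall y, 0 < y < 1 -> is_derive W y (W y * (2 * s y) / (y * (1 - y)))).
  { intros y Hy. apply (is_derive_ext (fun z => 1 * z ^ a * (1 - z) ^ b)).
    { intros z. unfold W. eqR. ring. }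
    evar_last; [apply is_derive_weight|]. eqR.
    assert (E1 : INR a * y ^ pred a = INR a * y ^ a / y).
    { destruct a; [lia|]. simpl pred. simpl (y ^ _). field. lra. }
    assert (E2 : INR b * (1 - y) ^ pred b = INR b * (1 - y) ^ b / (1 - y)).
    { destruct b; simpl pred; simpl ((1 - y) ^ _); simpl (INR 0); field; lra. }
    rewrite E1, E2. unfold W, s. field. lra. }
  assert (DS : forall y, 0 < y < 1 ->
     is_derive S y ((- q y * P y - s y * S y) / (y * (1 - y)))).
  { intros y Hy.
    pose proof (HP y) as H0. pose proof (HP1 y) as H1.
    evar_last.
    - unfold S, s. auto_derive.
      + repeat split; [eexists; exact H0|eexists; exact H1].
      + replace (Derive (fun x => P x) y) with (P1 y)
          by (symmetry; apply is_derive_unique, H0).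
        replace (Derive (fun x => P1 x) y) with (P2 y)
          by (symmetry; apply is_derive_unique, H1).
        reflexivity.
    - eqR. specialize (Hode y Hy).
      assert (E2 : P2 y = (- (INR a + 1 - (INR a + INR b + 2) * y) * P1 y
         - INR n * (INR n + INR a + INR b + 1) * P y) / (y * (1 - y))).
      { apply (Rmult_eq_reg_l (y * (1 - y))); [|nra]. field_simplify; [lra|lra]. }
      rewrite E2. unfold q, qpot, S, s.
      replace (jac_u n a b ^ 2 * (1 - y) * (y - INR a ^ 2 / (4 * jac_u n a b ^ 2)))
        with (jac_u n a b ^ 2 * (1 - y) * y - INR a ^ 2 / 4 * (1 - y)) by (field; lra).
      unfold jac_u. field. lra. }
  exists (fun y => W y * P y * S y), (fun y => W y * S y * S y).
  assert (W0 : W 0 = 0). { unfold W. rewrite pow_i by lia. ring. }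
  assert (EW : forall y, ex_derive W y). { intros y. apply ex_derive_beta. }
  assert (EP : forall y, ex_derive P y). { intros y. eexists. apply HP. }
  assert (ES : forall y, ex_derive S y).
  { intros y. unfold S, s. auto_derive. repeat split; [apply EP|eexists; apply HP1]. }
  assert (Wge : forall y, 0 <= y <= 1 -> 0 <= W y).
  { intros y Hy. unfold W. apply Rmult_le_pos; apply pow_le; lra. }
  fold q.
  constructor.
  - intros y Hy. apply (is_derive_ext (fun z => W z * P z * P z)); [intros z; symmetry; apply HA|].
    eapply is_derive_mulR; [eapply is_derive_mulR; [apply DW, Hy|apply HP|reflexivity]|apply HP|].
    unfold S. field. lra.
  - intros y Hy.
    eapply is_derive_mulR; [eapply is_derive_mulR; [apply DW, Hy|apply HP|reflexivity]|apply DS, Hy|].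
    rewrite HA. fold q. unfold S. field. lra.
  - intros y Hy.
    eapply is_derive_mulR; [eapply is_derive_mulR; [apply DW, Hy|apply DS, Hy|reflexivity]|apply DS, Hy|].
    fold q. unfold S. field. lra.
  - intros y. apply continuity_pt_of_ex_derive, ex_derive_jac_density.
  - intros y. apply continuity_pt_of_ex_derive. auto_derive. auto.
  - intros y. apply continuity_pt_of_ex_derive. auto_derive. auto.
  - intros y Hy. rewrite HA, Rmult_assoc. apply Rmult_le_pos; [auto|apply Rle_0_sqr].
  - intros y Hy. rewrite Rmult_assoc. apply Rmult_le_pos; [auto|apply Rle_0_sqr].
  - intros y. rewrite HA. ring.
  - rewrite HA, W0. ring.
  - rewrite W0. ring.
  - rewrite W0. ring.
  - pose proof (RInt_jac_density_le n a b) as H.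
    replace (INR (2 * n + a + b + 1)) with (2 * jac_u n a b) in H.
    + apply (Rmult_le_reg_l (2 * jac_u n a b)); [lra|]. rewrite Rinv_r by lra. exact H.
    + unfold jac_u. rewrite !plus_INR, mult_INR. simpl (INR 2). simpl (INR 1). field.
Qed.

(** * Monotonicity and Gronwall tools *)

Lemma le_of_derive_ge0 (f f' : R -> R) (a b : R) :
  a <= b -> (forall y, a < y < b -> is_derive f y (f' y)) ->
  (forall y, a <= y <= b -> continuity_pt f y) ->
  (forall y, a < y < b -> 0 <= f' y) -> f a <= f b.
Proof.
  intros Hab Hd Hc Hp.
  destruct (Req_dec a b) as [->|Hne]; [lra|].
  (* The mean value point may be an endpoint, where nothing is known about [f']; extending the
     derivative by [0] makes its sign known there too. *)
  destruct (MVT_gen f a b (fun y => if Rlt_dec a y then if Rlt_dec y b then f' y else 0 else 0))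
    as (c & Hc1 & Hc2); rewrite ?Rmin_left, ?Rmax_right in * by lra.
  - intros y Hy. destruct (Rlt_dec a y); [|lra]. destruct (Rlt_dec y b); [|lra]. auto.
  - exact Hc.
  - assert (0 <= (if Rlt_dec a c then if Rlt_dec c b then f' c else 0 else 0)).
    { destruct (Rlt_dec a c), (Rlt_dec c b); try lra. auto. }
    nra.
Qed.

(** Both [- f y * exp (- L * y)] and [f y * exp (L * y)] are nondecreasing. The second bound serves
    to move from right to left. *)
Lemma gronwall_two_sided (L : R) (f f' : R -> R) (a b : R) :
  a <= b -> (forall y, a < y < b -> is_derive f y (f' y)) ->
  (forall y, a <= y <= b -> continuity_pt f y) ->
  (forall y, a < y < b -> Rabs (f' y) <= L * f y) ->
  f b <= f a * exp (L * (b - a)) /\ f a <= f b * exp (L * (b - a)).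
Proof.
  intros Hab Hd Hc Hp.
  assert (Hexp : forall c y, continuity_pt (fun z => exp (c * z)) y).
  { intros c y. apply continuity_pt_of_ex_derive. auto_derive. auto. }
  split.
  - pose proof (le_of_derive_ge0 (fun z => - f z * exp (- L * z))
      (fun z => (L * f z - f' z) * exp (- L * z)) a b Hab) as H.
    assert (H1 : - f a * exp (- L * a) <= - f b * exp (- L * b)).
    { apply H.
      - intros y Hy. specialize (Hd y Hy). auto_derive.
        + eexists; exact Hd.
        + replace (Derive (fun x => f x) y) with (f' y)
            by (symmetry; apply is_derive_unique, Hd). ring.
      - intros y Hy. apply continuity_pt_mult; [apply continuity_pt_opp, Hc, Hy|apply Hexp].
      - intros y Hy. specialize (Hp y Hy). apply Rabs_le_between in Hp.
        pose proof (exp_pos (- L * y)). nra. }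
    replace (L * (b - a)) with (L * b + - L * a) by ring. rewrite exp_plus.
    replace (- L * b) with (- (L * b)) in H1 by ring. rewrite (exp_Ropp (L * b)) in H1.
    pose proof (exp_pos (L * b)) as Hb.
    assert (f b * / exp (L * b) <= f a * exp (- L * a)) by lra.
    apply (Rmult_le_compat_r (exp (L * b))) in H0; [|lra].
    rewrite Rmult_assoc, Rinv_l in H0 by lra. lra.
  - pose proof (le_of_derive_ge0 (fun z => f z * exp (L * z))
      (fun z => (L * f z + f' z) * exp (L * z)) a b Hab) as H.
    assert (H1 : f a * exp (L * a) <= f b * exp (L * b)).
    { apply H.
      - intros y Hy. specialize (Hd y Hy). auto_derive.
        + eexists; exact Hd.
        + replace (Derive (fun x => f x) y) with (f' y)
            by (symmetry; apply is_derive_unique, Hd). ring.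
      - intros y Hy. apply continuity_pt_mult; [apply Hc, Hy|apply Hexp].
      - intros y Hy. specialize (Hp y Hy). apply Rabs_le_between in Hp.
        pose proof (exp_pos (L * y)). nra. }
    replace (L * (b - a)) with (L * b + - (L * a)) by ring. rewrite exp_plus.
    rewrite (exp_Ropp (L * a)).
    pose proof (exp_pos (L * a)) as Hb.
    apply (Rmult_le_compat_r (/ exp (L * a))) in H1; [|left; apply Rinv_0_lt_compat; lra].
    rewrite Rmult_assoc, Rinv_r in H1 by lra. lra.
Qed.

(** * Growth on the far side [y <= t] of the turning point *)

Definition dqpot (u t b y : R) : R := u ^ 2 * (1 + t - 2 * y) - (1 - 2 * y) / 4 - b ^ 2 / 4.

Lemma is_derive_qpot (u t b y : R) : is_derive (qpot u t b) y (dqpot u t b y).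
Proof. unfold qpot, dqpot. auto_derive; [easy|]. field. Qed.

Lemma qpot_cont (u t b y : R) : continuity_pt (qpot u t b) y.
Proof. apply continuity_pt_of_ex_derive. eexists. apply is_derive_qpot. Qed.

Section Oscillation.

Variables (u t b : R) (A B C : R -> R).
Hypothesis HT : osc_triple u t b A B C.

Let q := qpot u t b.
Let dq := dqpot u t b.

(** The terms in [B] cancel and only the drift of [q] remains. *)
Lemma is_derive_energy (y : R) :
  0 < y < 1 -> is_derive (fun z => C z + q z * A z) y (dq y * A y).
Proof.
  intros Hy.
  pose proof (osc_C _ _ _ _ _ _ HT y Hy) as H1.
  pose proof (osc_A _ _ _ _ _ _ HT y Hy) as H2.
  pose proof (is_derive_qpot u t b y) as H3.
  evar_last.
  - apply (@is_derive_plus _ R_NormedModule); [exact H1|].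
    eapply is_derive_mulR; [exact H3|exact H2|reflexivity].
  - unfold plus; simpl. eqR. fold q dq. field. lra.
Qed.

Lemma energy_cont (y : R) : continuity_pt (fun z => C z + q z * A z) y.
Proof.
  apply continuity_pt_plus; [apply (osc_C_cont _ _ _ _ _ _ HT)|].
  apply continuity_pt_mult; [apply qpot_cont|apply (osc_A_cont _ _ _ _ _ _ HT)].
Qed.

Hypothesis Hu : 1 <= u.
Hypothesis Ht : 0 < t < 1.
Hypothesis Hb : (b ^ 2 + 1) / 4 <= u ^ 2 * (1 - t).

Lemma qpot_le (y : R) : 0 <= y <= 1 -> q y <= u ^ 2 * ((1 - y) * (y - t)).
Proof. intros Hy. unfold q, qpot. pose proof (pow2_ge_0 b). nra. Qed.

Lemma qpot_ge (y : R) :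
  0 <= y <= 1 -> u ^ 2 * ((1 - y) * (y - t)) - (b ^ 2 + 1) / 4 <= q y.
Proof. intros Hy. unfold q, qpot. pose proof (pow2_ge_0 b). nra. Qed.

Lemma qpot_le0 (y : R) : 0 <= y <= t -> q y <= 0.
Proof.
  intros Hy. pose proof (qpot_le y ltac:(lra)).
  assert (0 <= (1 - y) * (t - y)) by (apply Rmult_le_pos; lra).
  pose proof (pow2_ge_0 u). nra.
Qed.

(** Write [1 + t - 2 y = (1 - t) + 2 (t - y)]; the first part absorbs the terms without [u] by
    [Hb]. *)
Lemma dqpot_ge0 (y : R) : 0 <= y <= t -> 0 <= dq y.
Proof.
  intros Hy. unfold dq, dqpot. pose proof (pow2_ge_0 u).
  assert (0 <= u ^ 2 * (t - y)) by (apply Rmult_le_pos; lra). nra.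
Qed.

Lemma energy_ge0 (y : R) : 0 <= y <= t -> 0 <= C y + q y * A y.
Proof.
  intros Hy.
  replace 0 with (C 0 + q 0 * A 0) at 1
    by (rewrite (osc_C0 _ _ _ _ _ _ HT), (osc_A0 _ _ _ _ _ _ HT); ring).
  apply (le_of_derive_ge0 (fun z => C z + q z * A z) (fun z => dq z * A z)).
  - lra.
  - intros z Hz. apply is_derive_energy. lra.
  - intros z _. apply energy_cont.
  - intros z Hz. apply Rmult_le_pos; [apply dqpot_ge0; lra|].
    apply (osc_A_ge0 _ _ _ _ _ _ HT). lra.
Qed.

Lemma osc_B_ge0 (y : R) : 0 <= y <= t -> 0 <= B y.
Proof.
  intros Hy. rewrite <- (osc_B0 _ _ _ _ _ _ HT).
  apply (le_of_derive_ge0 B (fun z => (C z - q z * A z) / (z * (1 - z)))).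
  - lra.
  - intros z Hz. apply (osc_B _ _ _ _ _ _ HT). lra.
  - intros z _. apply (osc_B_cont _ _ _ _ _ _ HT).
  - intros z Hz. apply Rdiv_le_0_compat; [|nra].
    pose proof (osc_A_ge0 _ _ _ _ _ _ HT z ltac:(lra)).
    pose proof (osc_C_ge0 _ _ _ _ _ _ HT z ltac:(lra)).
    pose proof (qpot_le0 z ltac:(lra)). nra.
Qed.

(** Nonnegative energy gives [B ^ 2 = A * C >= - q * A ^ 2]. Since [D A = 2 B], this is a lower
    bound [2 X] for the logarithmic derivative of [A]. *)
Lemma osc_B_ge (y X : R) : 0 <= y <= t -> 0 <= X -> X ^ 2 <= - q y -> X * A y <= B y.
Proof.
  intros Hy HX HXq.
  pose proof (osc_A_ge0 _ _ _ _ _ _ HT y ltac:(lra)) as HA.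
  pose proof (osc_B_ge0 y Hy) as HB.
  pose proof (energy_ge0 y Hy) as HE.
  pose proof (osc_disc _ _ _ _ _ _ HT y) as HD.
  apply Rsqr_incr_0_var; [|exact HB]. unfold Rsqr.
  assert (0 <= A y * (C y + q y * A y)) by (apply Rmult_le_pos; lra).
  assert (X ^ 2 * (A y) ^ 2 <= - q y * (A y) ^ 2)
    by (apply Rmult_le_compat_r; [apply pow2_ge_0|lra]).
  nra.
Qed.

Lemma osc_A_mono (y y' : R) : 0 <= y <= y' -> y' <= t -> A y <= A y'.
Proof.
  intros Hy Hy'.
  apply (le_of_derive_ge0 A (fun z => 2 * B z / (z * (1 - z)))).
  - lra.
  - intros z Hz. apply (osc_A _ _ _ _ _ _ HT). lra.
  - intros z _. apply (osc_A_cont _ _ _ _ _ _ HT).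
  - intros z Hz. apply Rdiv_le_0_compat; [|nra].
    pose proof (osc_B_ge0 z ltac:(lra)). lra.
Qed.

(** The logarithmic derivative of [A] is at least [a * (1 / z - 1 / t)]. Integrating from [y] to [t]
    gives [A y <= A t * exp (a * (1 - y / t + ln (y / t)))], and [y <= t / 16] makes this at most
    [A t * (e / 16) ^ a]. *)
Lemma osc_A_exp_decay (a : nat) (y : R) :
  INR a ^ 2 = 4 * u ^ 2 * t -> 0 < y <= t / 16 -> A y <= A t * (/ 4) ^ a.
Proof.
  intros Ha Hy.
  pose proof (pos_INR a) as Ha0.
  pose proof (le_of_derive_ge0 (fun z => A z * exp (INR a * (z / t - ln z)))
    (fun z => (2 * B z / (z * (1 - z)) - INR a * (/ z - / t) * A z)
              * exp (INR a * (z / t - ln z))) y t ltac:(lra)) as H.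
  assert (H1 : A y * exp (INR a * (y / t - ln y)) <= A t * exp (INR a * (t / t - ln t))).
  { apply H.
    - intros z Hz. pose proof (osc_A _ _ _ _ _ _ HT z ltac:(lra)) as HA.
      auto_derive.
      + split; [eexists; exact HA|split; [lra|auto]].
      + replace (Derive (fun x => A x) z) with (2 * B z / (z * (1 - z)))
          by (symmetry; apply is_derive_unique, HA).
        change (z * / t + - ln z) with (z / t - ln z). field. lra.
    - intros z Hz. apply continuity_pt_mult; [apply (osc_A_cont _ _ _ _ _ _ HT)|].
      apply continuity_pt_of_ex_derive. auto_derive. lra.
    - intros z Hz. apply Rmult_le_pos; [|left; apply exp_pos].
      (* Here [- q >= a ^ 2 / 4 * m] with [m = (1 - z) * (1 - z / t)] in [[0, 1]]. Taking [m] in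
         place of its square root is weaker but leaves an explicit primitive. *)
      assert (HB : INR a / 2 * (1 - z) * (1 - z / t) * A z <= B z).
      { apply osc_B_ge; [lra| |].
        - assert (z / t <= 1) by (apply Rle_div_l; lra).
          apply Rmult_le_pos; [apply Rmult_le_pos; lra|lra].
        - pose proof (qpot_le z ltac:(lra)) as Hq.
          assert (E : u ^ 2 * ((1 - z) * (z - t)) = - (INR a ^ 2 / 4 * (1 - z) * (1 - z / t))).
          { rewrite Ha. field. lra. }
          rewrite E in Hq.
          assert (0 <= z / t) by (apply Rdiv_le_0_compat; lra).
          assert (z / t <= 1) by (apply Rle_div_l; lra).
          assert ((1 - z) * (1 - z / t) * ((1 - z) * (1 - z / t)) <= (1 - z) * (1 - z / t) * 1).
          { apply Rmult_le_compat_l; [apply Rmult_le_pos; lra|].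
            replace 1 with (1 * 1) at 3 by ring. apply Rmult_le_compat; lra. }
          pose proof (pow2_ge_0 (INR a)). nra. }
      assert (E : 2 * B z / (z * (1 - z)) - INR a * (/ z - / t) * A z
                  = 2 / (z * (1 - z)) * (B z - INR a / 2 * (1 - z) * (1 - z / t) * A z)).
      { field. lra. }
      rewrite E. apply Rmult_le_pos; [|lra].
      apply Rdiv_le_0_compat; [lra|nra]. }
  assert (E1 : A t * exp (INR a * (t / t - ln t)) =
     A t * exp (INR a * (1 - ln t - (y / t - ln y))) * exp (INR a * (y / t - ln y))).
  { rewrite Rmult_assoc, <- exp_plus. f_equal. f_equal. field. lra. }
  rewrite E1 in H1. apply Rmult_le_reg_r in H1; [|apply exp_pos].
  eapply Rle_trans; [exact H1|].
  apply Rmult_le_compat_l; [apply (osc_A_ge0 _ _ _ _ _ _ HT); lra|].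
  replace ((/ 4) ^ a) with (exp (INR a * - ln 4)).
  (* [ln 16 = 2 * ln 4]: one [ln 4 >= 1] pays for the loss [exp a], the other is the claimed
     decay. *)
  - assert (Hx : 1 - ln t - (y / t - ln y) <= - ln 4).
    { assert (ln (16 * y) <= ln t) by (apply ln_le; lra).
      rewrite ln_mult in H0 by lra.
      replace 16 with (4 * 4) in H0 by ring. rewrite (ln_mult 4 4) in H0 by lra.
      assert (1 <= ln 4).
      { rewrite <- (ln_exp 1). apply ln_le; [apply exp_pos|]. pose proof exp_le_3. lra. }
      assert (0 <= y / t) by (apply Rdiv_le_0_compat; lra). lra. }
    destruct (Rle_lt_or_eq_dec _ _ (Rmult_le_compat_l _ _ _ Ha0 Hx)) as [Hlt|Heq].
    + left. apply exp_increasing, Hlt.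
    + rewrite Heq. lra.
  - rewrite <- ln_Rinv by lra. rewrite <- (exp_ln (/ 4)) at 2 by lra.
    clear. induction a as [|a IH]; [simpl; rewrite Rmult_0_l; apply exp_0|].
    rewrite S_INR, Rmult_plus_distr_r, Rmult_1_l, exp_plus, IH. simpl. ring.
Qed.

(** Within [z ^ 2 / u ^ 2] of [t] the weight is at most [sqrt 3 * z] and [A] is monotone. Further
    left [A] grows at logarithmic rate at least [2 z / x], faster than the weight shrinks, because
    [u ^ 2 * x <= u ^ 2 * t = z ^ 3 / 4]; so the product is monotone up to [s]. *)
Lemma osc_A_left (z y : R) :
  0 < z -> z ^ 3 = 4 * u ^ 2 * t -> 0 <= y <= t ->
  A y * sqrt (z ^ 2 + 2 * u ^ 2 * (t - y)) <= 2 * z * A t.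
Proof.
  intros Hz Hzt Hy.
  set (s := t - z ^ 2 / u ^ 2).
  assert (Hu2 : 0 < u ^ 2) by (apply pow_lt; lra).
  assert (Hz2 : 0 < z ^ 2) by (apply pow_lt; lra).
  assert (Hs : forall x, s <= x -> u ^ 2 * (t - x) <= z ^ 2).
  { intros x Hx. assert (u ^ 2 * (t - x) <= u ^ 2 * (z ^ 2 / u ^ 2))
      by (apply Rmult_le_compat_l; unfold s in *; lra).
    replace (u ^ 2 * (z ^ 2 / u ^ 2)) with (z ^ 2) in H by (field; lra). lra. }
  assert (Hcase : forall x, 0 <= x <= t -> s <= x ->
     A x * sqrt (z ^ 2 + 2 * u ^ 2 * (t - x)) <= 2 * z * A t).
  { intros x Hx Hsx. specialize (Hs x Hsx).
    rewrite (Rmult_comm _ (A t)).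
    apply Rmult_le_compat; [apply (osc_A_ge0 _ _ _ _ _ _ HT); lra|apply sqrt_pos| |].
    - apply osc_A_mono; lra.
    - rewrite <- (sqrt_pow2 (2 * z)) by lra. apply sqrt_le_1_alt. nra. }
  destruct (Rle_dec s y) as [H|H]; [apply Hcase; auto|].
  apply Rnot_le_lt in H.
  eapply Rle_trans; [|apply (Hcase s); unfold s in *; [|lra]].
  2:{ split; [lra|]. assert (0 < z ^ 2 / u ^ 2) by (apply Rdiv_lt_0_compat; lra). lra. }
  assert (Hst : s <= t).
  { unfold s. assert (0 < z ^ 2 / u ^ 2) by (apply Rdiv_lt_0_compat; lra). lra. }
  apply (le_of_derive_ge0 (fun x => A x * sqrt (z ^ 2 + 2 * u ^ 2 * (t - x)))
    (fun x => (2 * B x / (x * (1 - x)) - u ^ 2 / (z ^ 2 + 2 * u ^ 2 * (t - x)) * A x)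
              * sqrt (z ^ 2 + 2 * u ^ 2 * (t - x)))); [lra| | |].
  - intros x Hx. pose proof (osc_A _ _ _ _ _ _ HT x ltac:(lra)) as HA.
    assert (Hp : 0 < z ^ 2 + 2 * u ^ 2 * (t - x)) by nra.
    assert (Hsq : sqrt (z ^ 2 + 2 * u ^ 2 * (t - x)) <> 0).
    { apply Rgt_not_eq, sqrt_lt_R0, Hp. }
    eapply is_derive_mulR; [exact HA| |].
    + apply (is_derive_sqrt (fun x => z ^ 2 + 2 * u ^ 2 * (t - x)) x (- (2 * u ^ 2))); [|exact Hp].
      auto_derive; [auto|ring].
    + assert (E : u ^ 2 / (z ^ 2 + 2 * u ^ 2 * (t - x)) * sqrt (z ^ 2 + 2 * u ^ 2 * (t - x))
        = u ^ 2 / sqrt (z ^ 2 + 2 * u ^ 2 * (t - x))).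
      { rewrite <- (sqrt_sqrt (z ^ 2 + 2 * u ^ 2 * (t - x))) at 1 by lra. field. exact Hsq. }
      match goal with |- _ = ?R => transitivity
        (2 * B x / (x * (1 - x)) * sqrt (z ^ 2 + 2 * u ^ 2 * (t - x))
         - A x * (u ^ 2 / (z ^ 2 + 2 * u ^ 2 * (t - x)) * sqrt (z ^ 2 + 2 * u ^ 2 * (t - x)))) end.
      * rewrite E. field. split; [exact Hsq|lra].
      * ring.
  - intros x Hx. apply continuity_pt_mult; [apply (osc_A_cont _ _ _ _ _ _ HT)|].
    apply continuity_pt_of_ex_derive. auto_derive.
    assert (0 <= u ^ 2 * (t - x)) by (apply Rmult_le_pos; lra). nra.
  - intros x Hx. apply Rmult_le_pos; [|apply sqrt_pos].
    assert (Hx1 : z ^ 2 <= u ^ 2 * (t - x)).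
    { assert (u ^ 2 * (z ^ 2 / u ^ 2) <= u ^ 2 * (t - x))
        by (apply Rmult_le_compat_l; unfold s in *; lra).
      replace (u ^ 2 * (z ^ 2 / u ^ 2)) with (z ^ 2) in H0 by (field; lra). lra. }
    assert (HB : (1 - x) * z * A x <= B x).
    { apply osc_B_ge; [lra|apply Rmult_le_pos; lra|].
      pose proof (qpot_le x ltac:(lra)) as Hq.
      assert ((1 - x) * ((1 - x) * z ^ 2) <= 1 * ((1 - x) * z ^ 2)).
      { apply Rmult_le_compat_r; [apply Rmult_le_pos; lra|lra]. }
      assert ((1 - x) * z ^ 2 <= (1 - x) * (u ^ 2 * (t - x))) by (apply Rmult_le_compat_l; lra).
      nra. }
    pose proof (osc_A_ge0 _ _ _ _ _ _ HT x ltac:(lra)) as HA.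
    set (w := z ^ 2 + 2 * u ^ 2 * (t - x)) in *.
    assert (Hw : 3 * z ^ 2 <= w) by (unfold w; lra).
    assert (H1 : u ^ 2 / w <= 2 * z / x).
    { apply Rle_div_l; [lra|]. 
      assert (Hxu : u ^ 2 * x <= 2 * z * w).
      { assert (u ^ 2 * x <= u ^ 2 * t) by (apply Rmult_le_compat_l; lra).
        assert (2 * z * (3 * z ^ 2) <= 2 * z * w) by (apply Rmult_le_compat_l; lra). nra. }
      replace (2 * z / x * w) with ((2 * z * w) / x) by (field; lra).
      apply (proj1 (Rle_div_r (u ^ 2) (2 * z * w) x ltac:(lra)) Hxu). }
    assert (H2 : 2 * z / x * A x <= 2 * B x / (x * (1 - x))).
    { replace (2 * z / x * A x) with (2 / (x * (1 - x)) * ((1 - x) * z * A x)) by (field; lra).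
      replace (2 * B x / (x * (1 - x))) with (2 / (x * (1 - x)) * B x) by (field; lra).
      apply Rmult_le_compat_l; [|exact HB]. apply Rdiv_le_0_compat; [lra|nra]. }
    assert (u ^ 2 / w * A x <= 2 * z / x * A x) by (apply Rmult_le_compat_r; auto).
    lra.
Qed.

End Oscillation.

(** * Energy bound on compact sets away from the turning point *)

Section Amplitude.

Variables (u t b : R) (A B C : R -> R).
Hypothesis HT : osc_triple u t b A B C.

Let q := qpot u t b.
Let dq := dqpot u t b.

Hypothesis Hu : 1 <= u.

(** [Phi = y (1 - y) B - (1 - 2 y) y (1 - y) A / 2] vanishes at both endpoints and satisfies
    [Phi' = C - (q + O(1)) A], so the integral of [C] is controlled by that of [A]. *)
Lemma exists_small_energy (l : R) :
  0 < t < 1 -> 0 < l < 1 ->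
  exists y, 1 - l / 2 <= y <= 1 - l / 4 /\ C y + u ^ 2 * A y <= 6 / l * u.
Proof.
  intros Ht Hl.
  set (G := fun y => RInt A 0 y).
  assert (HAc : forall y, continuous A y).
  { intros y. apply continuity_pt_filterlim, (osc_A_cont _ _ _ _ _ _ HT). }
  assert (DG : forall y, is_derive G y (A y)).
  { intros y. apply (is_derive_RInt A G 0 y).
    - exists (mkposreal 1 Rlt_0_1). intros z _.
      apply (RInt_correct (V := R_CompleteNormedModule)).
      apply (ex_RInt_continuous (V := R_CompleteNormedModule)). intros; apply HAc.
    - apply HAc. }
  (* The multiple [3 u ^ 2] of the integral of [A] absorbs [q + O(1)] and still leaves [u ^ 2 * A]
     in the derivative. *)
  set (H := fun y => y * (1 - y) * B y - (1 - 2 * y) * (y * (1 - y)) / 2 * A y + 3 * u ^ 2 * G y).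
  set (H' := fun y => C y + (3 * u ^ 2 - q y - ((1 - 2 * y) ^ 2 - 2 * (y * (1 - y))) / 2) * A y).
  assert (DH : forall y, 0 < y < 1 -> is_derive H y (H' y)).
  { intros y Hy.
    pose proof (osc_A _ _ _ _ _ _ HT y Hy) as HA.
    pose proof (osc_B _ _ _ _ _ _ HT y Hy) as HB.
    unfold H. auto_derive.
    - repeat split; [eexists; exact HB|eexists; exact HA|eexists; apply DG].
    - replace (Derive (fun x => A x) y) with (2 * B y / (y * (1 - y)))
        by (symmetry; apply is_derive_unique, HA).
      replace (Derive (fun x => B x) y) with ((C y - q y * A y) / (y * (1 - y)))
        by (symmetry; apply is_derive_unique, HB).
      replace (Derive (fun x => G x) y) with (A y)
        by (symmetry; apply is_derive_unique, DG).
      unfold H'. field. lra. }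
  assert (CH : forall y, continuity_pt H y).
  { intros y. unfold H.
    apply continuity_pt_plus; [apply continuity_pt_minus|]; apply continuity_pt_mult.
    - apply continuity_pt_of_ex_derive. auto_derive. auto.
    - apply (osc_B_cont _ _ _ _ _ _ HT).
    - apply continuity_pt_of_ex_derive. auto_derive. auto.
    - apply (osc_A_cont _ _ _ _ _ _ HT).
    - apply continuity_pt_of_ex_derive. auto_derive. auto.
    - apply continuity_pt_of_ex_derive. eexists. apply DG. }
  assert (PH : forall y, 0 < y < 1 -> 0 <= C y + u ^ 2 * A y <= H' y).
  { intros y Hy.
    pose proof (osc_A_ge0 _ _ _ _ _ _ HT y ltac:(lra)) as HA.
    pose proof (osc_C_ge0 _ _ _ _ _ _ HT y ltac:(lra)) as HC.
    pose proof (qpot_le u t b y ltac:(lra)) as Hq. fold q in Hq.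
    assert (Hu2 : 1 <= u ^ 2) by nra.
    assert ((1 - y) * (y - t) <= 1) by nra.
    assert (u ^ 2 * ((1 - y) * (y - t)) <= u ^ 2 * 1) by (apply Rmult_le_compat_l; lra).
    assert (((1 - 2 * y) ^ 2 - 2 * (y * (1 - y))) / 2 <= 1) by nra.
    assert (u ^ 2 * A y <= (3 * u ^ 2 - q y - ((1 - 2 * y) ^ 2 - 2 * (y * (1 - y))) / 2) * A y)
      by (apply Rmult_le_compat_r; lra).
    assert (0 <= u ^ 2 * A y) by (apply Rmult_le_pos; lra).
    unfold H'. lra. }
  assert (MH : forall x y, 0 <= x -> x <= y -> y <= 1 -> H x <= H y).
  { intros x y Hx Hxy Hy. apply (le_of_derive_ge0 H H'); [lra| | |].
    - intros z Hz. apply DH. lra.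
    - intros z _. apply CH.
    - intros z Hz. specialize (PH z ltac:(lra)). lra. }
  assert (HH : H 1 - H 0 <= 3 / 2 * u).
  { unfold H, G. rewrite RInt_point. change (@zero R_CompleteNormedModule) with 0.
    pose proof (osc_norm _ _ _ _ _ _ HT) as Hn.
    assert (u ^ 2 * RInt A 0 1 <= u ^ 2 * / (2 * u))
      by (apply Rmult_le_compat_l; [apply pow2_ge_0|exact Hn]).
    replace (u ^ 2 * / (2 * u)) with (u / 2) in H0 by (field; lra). lra. }
  (* [H] is nondecreasing with total increment at most [3 / 2 * u], so on an interval of length
     [l / 4] its slope is somewhere at most [6 / l * u]. *)
  destruct (MVT_gen H (1 - l / 2) (1 - l / 4) H') as (c & Hc1 & Hc2);
    rewrite ?Rmin_left, ?Rmax_right in * by lra.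
  - intros y Hy. apply DH. lra.
  - intros y _. apply CH.
  - exists c. split; [exact Hc1|].
    pose proof (MH 0 (1 - l / 2) ltac:(lra) ltac:(lra) ltac:(lra)).
    pose proof (MH (1 - l / 4) 1 ltac:(lra) ltac:(lra) ltac:(lra)).
    specialize (PH c ltac:(lra)).
    apply Rle_trans with (H' c); [lra|].
    apply (Rmult_le_reg_r (1 - l / 4 - (1 - l / 2))); [lra|].
    rewrite <- Hc2. replace (6 / l * u * (1 - l / 4 - (1 - l / 2))) with (3 / 2 * u) by (field; lra).
    lra.
Qed.

(** On this range [|q'| <= 3 u ^ 2] while [q >= e * l / 16 * u ^ 2], so the logarithmic rate of the
    energy is at most [48 / (e * l)], free of [u]. Gronwall spreads the bound from the point of
    [exists_small_energy] in both directions. *)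
Lemma energy_le (l e : R) :
  0 < l < 1 -> 0 < e <= l / 4 -> 0 < t <= 1 - l ->
  4 * (b ^ 2 + 1) <= e * l ^ 2 * u ^ 2 ->
  forall y, t + l / 8 <= y <= 1 - e ->
    e * l / 16 * u ^ 2 <= q y /\ C y + q y * A y <= 6 / l * exp (48 / (e * l)) * u.
Proof.
  intros Hl He Ht HN.
  assert (Hu2 : 1 <= u ^ 2) by nra.
  assert (Hb0 : 0 <= b ^ 2) by apply pow2_ge_0.
  assert (Hel : 0 < e * l) by nra.
  assert (Hell : e * l ^ 2 * u ^ 2 <= e * l * u ^ 2).
  { apply Rmult_le_compat_r; [lra|]. nra. }
  assert (Helu : e * l * u ^ 2 <= u ^ 2).
  { rewrite <- (Rmult_1_l (u ^ 2)) at 2. apply Rmult_le_compat_r; [lra|nra]. }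
  assert (Hq : forall y, t + l / 8 <= y <= 1 - e -> e * l / 16 * u ^ 2 <= q y).
  { intros y Hy. pose proof (qpot_ge u t b y ltac:(lra)) as H. fold q in H.
    assert (e * (l / 8) <= (1 - y) * (y - t)) by (apply Rmult_le_compat; lra).
    assert (u ^ 2 * (e * (l / 8)) <= u ^ 2 * ((1 - y) * (y - t)))
      by (apply Rmult_le_compat_l; lra).
    lra. }
  assert (Hd : forall y, t + l / 8 <= y <= 1 - e ->
     Rabs (dq y * A y) <= 48 / (e * l) * (C y + q y * A y)).
  { intros y Hy. specialize (Hq y Hy).
    pose proof (osc_A_ge0 _ _ _ _ _ _ HT y ltac:(lra)) as HA.
    pose proof (osc_C_ge0 _ _ _ _ _ _ HT y ltac:(lra)) as HC.
    rewrite Rabs_mult, (Rabs_pos_eq (A y)) by lra.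
    assert (Rabs (dq y) <= 3 * u ^ 2).
    { apply Rabs_le. unfold dq, dqpot.
      assert (-1 <= 1 + t - 2 * y <= 2) by lra.
      assert (u ^ 2 * (1 + t - 2 * y) <= u ^ 2 * 2) by (apply Rmult_le_compat_l; lra).
      assert (u ^ 2 * (-1) <= u ^ 2 * (1 + t - 2 * y)) by (apply Rmult_le_compat_l; lra).
      lra. }
    apply Rle_trans with (3 * u ^ 2 * A y); [apply Rmult_le_compat_r; lra|].
    assert (48 / (e * l) * (e * l / 16 * u ^ 2) <= 48 / (e * l) * q y).
    { apply Rmult_le_compat_l; [|exact Hq]. apply Rdiv_le_0_compat; lra. }
    replace (48 / (e * l) * (e * l / 16 * u ^ 2)) with (3 * u ^ 2) in H0 by (field; lra).
    assert (3 * u ^ 2 * A y <= 48 / (e * l) * q y * A y) by (apply Rmult_le_compat_r; lra).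
    assert (0 <= 48 / (e * l) * C y).
    { apply Rmult_le_pos; [|exact HC]. apply Rdiv_le_0_compat; lra. }
    lra. }
  intros y Hy. split; [apply Hq, Hy|].
  destruct (exists_small_energy l ltac:(lra) Hl) as (x & Hx & HE).
  assert (Hx' : t + l / 8 <= x <= 1 - e) by lra.
  assert (HEx : C x + q x * A x <= 6 / l * u).
  { eapply Rle_trans; [|exact HE]. apply Rplus_le_compat_l.
    apply Rmult_le_compat_r; [apply (osc_A_ge0 _ _ _ _ _ _ HT); lra|].
    pose proof (qpot_le u t b x ltac:(lra)) as H. fold q in H.
    assert ((1 - x) * (x - t) <= 1) by nra.
    assert (u ^ 2 * ((1 - x) * (x - t)) <= u ^ 2 * 1) by (apply Rmult_le_compat_l; lra).
    lra. }
  set (L := 48 / (e * l)) in *.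
  assert (HL : 0 < L) by (apply Rdiv_lt_0_compat; lra).
  assert (Hexp : forall d, 0 <= d <= 1 -> 6 / l * u * exp (L * d) <= 6 / l * exp L * u).
  { intros d Hd'. rewrite (Rmult_assoc (6 / l) (exp L)), (Rmult_comm (exp L)), <- Rmult_assoc.
    apply Rmult_le_compat_l.
    - apply Rmult_le_pos; [apply Rdiv_le_0_compat|]; lra.
    - assert (Hle : L * d <= L) by nra.
      destruct (Rle_lt_or_eq_dec _ _ Hle) as [h|h]; [left; apply exp_increasing, h|rewrite h; lra]. }
  assert (Hfin : forall d, 0 <= d <= 1 ->
     C y + q y * A y <= (C x + q x * A x) * exp (L * d) ->
     C y + q y * A y <= 6 / l * exp L * u).
  { intros d Hd' H. eapply Rle_trans; [exact H|]. eapply Rle_trans; [|apply (Hexp d Hd')].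
    apply Rmult_le_compat_r; [left; apply exp_pos|exact HEx]. }
  destruct (Rle_dec x y) as [Hxy|Hxy].
  - apply (Hfin (y - x)); [lra|].
    apply (gronwall_two_sided L (fun z => C z + q z * A z) (fun z => dq z * A z) x y Hxy).
    + intros z Hz. apply (is_derive_energy u t b A B C HT). lra.
    + intros z _. apply (energy_cont u t b A B C HT).
    + intros z Hz. apply Hd. lra.
  - apply (Hfin (x - y)); [lra|].
    apply (gronwall_two_sided L (fun z => C z + q z * A z) (fun z => dq z * A z) y x ltac:(lra)).
    + intros z Hz. apply (is_derive_energy u t b A B C HT). lra.
    + intros z _. apply (energy_cont u t b A B C HT).
    + intros z Hz. apply Hd. lra.
Qed.

End Amplitude.

(** * Algebraic inequalities for the WKB amplitude *)

Lemma le_div_unit (x l : R) : 0 <= x -> 0 < l <= 1 -> x <= x / l.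
Proof.
  intros Hx Hl. apply (proj1 (Rle_div_r x x l ltac:(lra))).
  rewrite <- (Rmult_1_r x) at 2. apply Rmult_le_compat_l; lra.
Qed.

Lemma is_derive_div_sqrt (f g : R -> R) (y df dg d : R) :
  is_derive f y df -> is_derive g y dg -> 0 < g y ->
  d = (df - f y * dg / (2 * g y)) / sqrt (g y) ->
  is_derive (fun z => f z / sqrt (g z)) y d.
Proof.
  intros Hf Hg Hp ->.
  pose proof (sqrt_lt_R0 _ Hp) as Hs.
  evar_last.
  - apply (is_derive_div f (fun z => sqrt (g z)) y df (dg / (2 * sqrt (g y)))); [exact Hf| |lra].
    apply (is_derive_sqrt g y dg Hg Hp).
  - eqR. pose proof (sqrt_sqrt (g y) ltac:(lra)) as E.
    set (s := sqrt (g y)) in *. rewrite <- E. field. lra.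
Qed.

(** The sign of the derivative in [is_derive_J], with [r = y (1 - y)], [m = 1 - 2 y], [g = q'] and
    [v = q + ka]. Since [U <= 4 / l * g] and [6 U r |m| <= 3 / 2 * U], the constant [K1 = 1 + 6 / l]
    bounds the higher [D]-derivatives by [q1]. After a factor [q1] is removed, the rest is a
    quadratic form in [q1] and [v] dominated by [ka * v ^ 2]. *)
Lemma monotonicity_numerator_ge0 (l K1 ka r m g U v : R) :
  0 < l < 1 -> 0 <= r <= 1 / 4 -> -1 <= m <= 1 -> 0 <= g -> 0 <= U -> U * l <= 4 * g ->
  0 <= v -> K1 = 1 + 6 / l -> 2 * K1 <= ka -> 4 * K1 * (r * g) ^ 2 <= ka * v ^ 2 ->
  let q1 := r * g in
  let q2 := r * (m * g - 2 * U * r) in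
  let q3 := r * ((m ^ 2 - 2 * r) * g - 6 * U * r * m) in
  Rabs q2 <= K1 * q1 /\
  0 <= - (15 / 16) * q1 ^ 3 + 9 / 8 * q1 * q2 * v - / 4 * q3 * v ^ 2 + ka * q1 * v ^ 2.
Proof.
  intros Hl Hr Hm Hg HU HUg Hv HK1 Hka Hkv q1 q2 q3.
  assert (Hi : U <= 4 / l * g).
  { replace (4 / l * g) with (4 * g / l) by (field; lra). apply Rle_div_r; lra. }
  assert (Hil : 0 < / l) by (apply Rinv_0_lt_compat; lra).
  assert (HK1' : K1 * g = g + 3 / 2 * (4 / l * g)) by (rewrite HK1; field; lra).
  assert (HK1p : 1 <= K1) by (rewrite HK1; unfold Rdiv; lra).
  set (G := 4 / l * g) in *.
  assert (HUr : 0 <= U * r <= G / 4).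
  { split; [apply Rmult_le_pos; lra|]. 
    apply Rle_trans with (U * (1 / 4)); [apply Rmult_le_compat_l; lra|lra]. }
  assert (Hmg : - g <= m * g <= g) by (split; nra).
  assert (Hm2 : m ^ 2 <= 1) by nra.
  assert (Hm2g : - g <= (m ^ 2 - 2 * r) * g <= g).
  { assert (0 <= m ^ 2) by apply pow2_ge_0. split; nra. }
  assert (HUrm : - (G / 4) <= U * r * m <= G / 4) by (split; nra).
  assert (H2 : - (K1 * q1) <= q2 <= K1 * q1).
  { assert (- (K1 * g) <= m * g - 2 * U * r <= K1 * g) by (rewrite HK1'; lra).
    unfold q1, q2. replace (K1 * (r * g)) with (r * (K1 * g)) by ring.
    split; [|apply Rmult_le_compat_l; lra].
    replace (- (r * (K1 * g))) with (r * - (K1 * g)) by ring. apply Rmult_le_compat_l; lra. }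
  assert (H3 : q3 <= K1 * q1).
  { unfold q1, q3. replace (K1 * (r * g)) with (r * (K1 * g)) by ring.
    apply Rmult_le_compat_l; [lra|]. rewrite HK1'. lra. }
  split; [apply Rabs_le; exact H2|].
  assert (Hq1 : 0 <= q1) by (apply Rmult_le_pos; lra).
  assert (Hv2 : 0 <= v ^ 2) by apply pow2_ge_0.
  assert (E2 : q1 * v * - (K1 * q1) <= q1 * v * q2).
  { apply Rmult_le_compat_l; [apply Rmult_le_pos; lra|lra]. }
  assert (E3 : v ^ 2 * q3 <= v ^ 2 * (K1 * q1)) by (apply Rmult_le_compat_l; lra).
  assert (Hamgm : K1 * (2 * (q1 * v)) <= K1 * (q1 ^ 2 + v ^ 2)).
  { apply Rmult_le_compat_l; [lra|]. pose proof (pow2_ge_0 (q1 - v)). nra. }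
  assert (Hkv' : 2 * K1 * v ^ 2 <= ka * v ^ 2) by (apply Rmult_le_compat_r; lra).
  fold q1 in Hkv.
  assert (HK1q : q1 ^ 2 <= K1 * q1 ^ 2) by (pose proof (pow2_ge_0 q1); nra).
  assert (0 <= K1 * v ^ 2) by (apply Rmult_le_pos; lra).
  assert (0 <= K1 * q1 ^ 2) by (apply Rmult_le_pos; [lra|apply pow2_ge_0]).
  assert (Hpar : 0 <= ka * v ^ 2 - 15 / 16 * q1 ^ 2 - 9 / 8 * K1 * (q1 * v) - / 4 * K1 * v ^ 2).
  { lra. }
  assert (0 <= q1 * (ka * v ^ 2 - 15 / 16 * q1 ^ 2 - 9 / 8 * K1 * (q1 * v) - / 4 * K1 * v ^ 2))
    by (apply Rmult_le_pos; lra).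
  lra.
Qed.

(** Once [q >= ka], the corrections in [J] are small against the energy: with [T = q1 / (2 v)], the
    hypotheses force [T ^ 2 <= ka / 16], and the mixed term [T * B] is split by [B ^ 2 = A * C]. *)
Lemma amplitude_bounds (A B C K1 ka q q1 q2 : R) :
  0 <= A -> 0 <= C -> B ^ 2 = A * C -> 1 <= K1 -> K1 ^ 2 <= ka -> ka <= q ->
  0 <= q1 -> Rabs q2 <= K1 * q1 -> 4 * K1 * q1 ^ 2 <= ka * (q + ka) ^ 2 ->
  let v := q + ka in
  let J := C + q1 / (2 * v) * B + (q + 3 / 8 * (q1 / v) ^ 2 - q2 / (4 * v)) * A in
  C / 2 + v / 4 * A <= J <= 2 * (C + q * A).
Proof.
  intros HA HC HB HK1 HKka Hkaq Hq1 Hq2 Hq1v v J.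
  assert (Hka : 1 <= ka) by nra.
  assert (Hv : 0 < v) by (unfold v; lra).
  set (T := q1 / (2 * v)).
  assert (HT0 : 0 <= T) by (apply Rdiv_le_0_compat; lra).
  assert (Eq1 : q1 = 2 * v * T) by (unfold T; field; lra).
  assert (HT2 : 16 * K1 * T ^ 2 <= ka).
  { fold v in Hq1v. rewrite Eq1 in Hq1v.
    apply (Rmult_le_reg_r (v ^ 2)); [apply pow_lt; lra|]. lra. }
  assert (HTka : T ^ 2 <= ka / 16) by (pose proof (pow2_ge_0 T); nra).
  set (Z := q2 / (4 * v)).
  assert (HZ : - (K1 * T / 2) <= Z <= K1 * T / 2).
  { apply Rabs_le_between. unfold Z, Rdiv. rewrite Rabs_mult, (Rabs_pos_eq (/ (4 * v)))
      by (left; apply Rinv_0_lt_compat; lra).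
    apply Rle_div_l; [lra|]. rewrite Eq1 in Hq2. lra. }
  assert (EJ : J = C + T * B + (q + 3 / 2 * T ^ 2 - Z) * A).
  { unfold J. fold T Z. rewrite Eq1. field. lra. }
  assert (HTB : - (C / 2 + T ^ 2 / 2 * A) <= T * B <= C / 2 + T ^ 2 / 2 * A).
  { apply Rabs_le_between.
    pose proof (pow2_ge_0 T).
    assert (0 <= T ^ 2 * A) by (apply Rmult_le_pos; lra).
    rewrite <- (Rabs_pos_eq (C / 2 + T ^ 2 / 2 * A)) by lra.
    apply Rsqr_le_abs_0. unfold Rsqr.
    pose proof (pow2_ge_0 (C / 2 - T ^ 2 / 2 * A)).
    replace (T * B * (T * B)) with (T ^ 2 * (A * C)) by (rewrite <- HB; ring). nra. }
  assert (HKT : K1 * T / 2 <= T ^ 2 + K1 ^ 2 / 16) by (pose proof (pow2_ge_0 (T - K1 / 4)); nra).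
  rewrite EJ. split.
  - assert (v / 4 * A <= (q + T ^ 2 - Z) * A) by (apply Rmult_le_compat_r; unfold v; lra).
    lra.
  - assert ((q + 2 * T ^ 2 - Z) * A <= 2 * q * A) by (apply Rmult_le_compat_r; lra).
    lra.
Qed.

(** [l] is the room between [t] and [1], [e] the distance kept from [y = 1], [z] the Airy scale and
    [k ^ 2 * z ^ 2] the shift [ka]. The constant [k] is chosen from [l] and [b], then [u] is taken
    large; [reg_uk] says that the transition zone, of length [4 ka / (l u ^ 2)], fits into
    [l / 4]. *)
Record osc_regime (l e k u t b z : R) : Prop := {
  reg_l : 0 < l < 1;
  reg_e : 0 < e <= l / 4;
  reg_t : 0 < t <= 1 - l;
  reg_u : 1 <= u;
  reg_z : 1 <= z;
  reg_zt : z ^ 3 = 4 * u ^ 2 * t;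
  reg_kl : 300 * (1 + 6 / l) / l ^ 2 <= k;
  reg_kb : b ^ 2 + 1 <= k;
  reg_kk : (1 + 6 / l) ^ 2 <= k;
  reg_ub : 4 * (b ^ 2 + 1) <= e * l ^ 2 * u ^ 2;
  reg_uk : 16 * (k ^ 2 * z ^ 2) <= l ^ 2 * u ^ 2
}.

(** * From the oscillatory region through the Airy zone *)

Section Transition.

Variables (l e k u t b z : R) (A B C : R -> R).
Hypothesis HT : osc_triple u t b A B C.
Hypothesis HR : osc_regime l e k u t b z.

Let q := qpot u t b.
Let dq := dqpot u t b.
Let K1 := 1 + 6 / l.
Let ka := k ^ 2 * z ^ 2.
(** [- 2 U] is the constant second derivative of [q], and [q1], [q2], [q3] are [D q], [D (D q)],
    [D (D (D q))]. *)
Let U := u ^ 2 - / 4.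
Let q1 (y : R) := y * (1 - y) * dq y.
Let q2 (y : R) := y * (1 - y) * ((1 - 2 * y) * dq y - 2 * U * (y * (1 - y))).
Let q3 (y : R) := y * (1 - y) * (((1 - 2 * y) ^ 2 - 2 * (y * (1 - y))) * dq y
                                 - 6 * U * (y * (1 - y)) * (1 - 2 * y)).

Lemma regime_k : 7 <= K1 /\ K1 <= k /\ 36 * K1 <= k /\ 300 * K1 <= k * l ^ 2 /\ 1 <= k /\ k <= ka
  /\ b ^ 2 + 1 <= ka /\ K1 ^ 2 <= ka /\ 0 <= b ^ 2.
Proof.
  destruct HR. fold K1 in reg_kl0, reg_kk0.
  assert (Hi : 1 <= / l) by (rewrite <- Rinv_1; apply Rinv_le_contravar; lra).
  assert (HK : 7 <= K1) by (unfold K1, Rdiv; lra).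
  assert (Hl2 : 0 < l ^ 2 <= 1) by nra.
  assert (H300 : 300 * K1 <= k * l ^ 2) by (apply Rle_div_l; [lra|]; exact reg_kl0).
  assert (Hk0 : 0 <= k) by nra.
  assert (H36 : 300 * K1 <= k) by nra.
  assert (Hka : k <= ka).
  { unfold ka. assert (1 <= z ^ 2) by nra. assert (k <= k ^ 2) by nra.
    assert (k ^ 2 * 1 <= k ^ 2 * z ^ 2) by (apply Rmult_le_compat_l; nra). lra. }
  pose proof (pow2_ge_0 b). repeat split; lra.
Qed.

Lemma regime_u : 1 <= u ^ 2 /\ 16 * ka <= l ^ 2 * u ^ 2
  /\ 4 * (b ^ 2 + 1) <= l ^ 3 * u ^ 2 / 4 /\ l ^ 3 * u ^ 2 <= l ^ 2 * u ^ 2 <= l * u ^ 2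
  /\ l * u ^ 2 <= u ^ 2.
Proof.
  destruct HR.
  assert (Hu2 : 1 <= u ^ 2) by nra.
  assert (Hll : 0 < l ^ 2 <= l) by nra.
  assert (Hlll : l ^ 3 <= l ^ 2) by nra.
  split; [exact Hu2|]. split; [exact reg_uk0|]. split.
  - eapply Rle_trans; [exact reg_ub0|].
    replace (l ^ 3 * u ^ 2 / 4) with (l / 4 * l ^ 2 * u ^ 2) by field.
    apply Rmult_le_compat_r; [lra|]. apply Rmult_le_compat_r; lra.
  - repeat split; try (apply Rmult_le_compat_r; lra).
    rewrite <- (Rmult_1_l (u ^ 2)) at 2. apply Rmult_le_compat_r; lra.
Qed.

Lemma regime_b : (b ^ 2 + 1) / 4 <= u ^ 2 * (1 - t).
Proof.
  pose proof regime_u as Hu. pose proof regime_k as Hk. destruct HR.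
  assert (u ^ 2 * l <= u ^ 2 * (1 - t)) by (apply Rmult_le_compat_l; lra). lra.
Qed.

Lemma dqpot_bounds (y : R) : t <= y <= t + l / 4 -> l / 4 * u ^ 2 <= dq y <= 3 * u ^ 2.
Proof.
  intros Hy. pose proof regime_u as Hu. pose proof regime_k as Hk. destruct HR.
  unfold dq, dqpot.
  assert (u ^ 2 * (l / 2) <= u ^ 2 * (1 + t - 2 * y)) by (apply Rmult_le_compat_l; lra).
  assert (u ^ 2 * (1 + t - 2 * y) <= u ^ 2 * 1) by (apply Rmult_le_compat_l; lra).
  split; lra.
Qed.

Lemma shifted_qpot_ge (y : R) :
  t <= y <= t + l / 4 ->
  3 / 4 * l * (u ^ 2 * (y - t)) + ka / 2 <= q y + ka /\ 0 < y * (1 - y) <= 1 / 4.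
Proof.
  intros Hy. pose proof regime_u as Hu. pose proof regime_k as Hk. destruct HR.
  assert (Hr : 0 < y * (1 - y) <= 1 / 4).
  { split; [apply Rmult_lt_0_compat; lra|]. pose proof (pow2_ge_0 (y - 1 / 2)). nra. }
  split; [|exact Hr].
  pose proof (qpot_ge u t b y ltac:(lra)) as H. fold q in H.
  assert (0 <= u ^ 2 * (y - t)) by (apply Rmult_le_pos; lra).
  assert (3 / 4 * l * (u ^ 2 * (y - t)) <= (1 - y) * (u ^ 2 * (y - t)))
    by (apply Rmult_le_compat_r; lra).
  lra.
Qed.

(** For [y <= 2 t] both sides are on the Airy scale: [q1 = O(z ^ 3)] and
    [q + ka >= k ^ 2 * z ^ 2 / 2], so a large [k] wins. For [y > 2 t] one has [y - t >= y / 2], both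
    [q1] and [q + ka] are comparable to [u ^ 2 * y], and the factor [ka >= k] suffices. *)
Lemma slope_le_shifted_qpot (y : R) :
  t <= y <= t + l / 4 -> 4 * K1 * q1 y ^ 2 <= ka * (q y + ka) ^ 2.
Proof.
  intros Hy. pose proof regime_u as Hu. pose proof regime_k as Hk.
  pose proof (dqpot_bounds y Hy) as Hd.
  destruct (shifted_qpot_ge y Hy) as [Hv Hr].
  destruct HR.
  assert (Hq1 : 0 <= q1 y <= y * (3 * u ^ 2)).
  { unfold q1. split; [apply Rmult_le_pos; lra|].
    rewrite Rmult_assoc. apply Rmult_le_compat_l; [lra|].
    rewrite <- (Rmult_1_l (3 * u ^ 2)). apply Rmult_le_compat; lra. }
  set (v := q y + ka) in *.
  destruct (Rle_dec y (2 * t)) as [H2t|H2t].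
  - assert (Hq1z : q1 y <= 3 / 2 * z ^ 3).
    { rewrite reg_zt0. assert (y * (3 * u ^ 2) <= 2 * t * (3 * u ^ 2)) by (apply Rmult_le_compat_r; lra).
      lra. }
    assert (Hv2 : ka / 2 <= v).
    { assert (0 <= 3 / 4 * l * (u ^ 2 * (y - t))).
      { apply Rmult_le_pos; [lra|]. apply Rmult_le_pos; lra. } lra. }
    assert (S1 : q1 y ^ 2 <= (3 / 2 * z ^ 3) ^ 2) by (apply pow_incr; lra).
    assert (S2 : (ka / 2) ^ 2 <= v ^ 2) by (apply pow_incr; lra).
    assert (S3 : ka * (ka / 2) ^ 2 <= ka * v ^ 2) by (apply Rmult_le_compat_l; lra).
    assert (S4 : 4 * K1 * q1 y ^ 2 <= 4 * K1 * (3 / 2 * z ^ 3) ^ 2)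
      by (apply Rmult_le_compat_l; lra).
    eapply Rle_trans; [exact S4|]. eapply Rle_trans; [|exact S3].
    replace (4 * K1 * (3 / 2 * z ^ 3) ^ 2) with (36 * K1 * (z ^ 6 / 4)) by field.
    replace (ka * (ka / 2) ^ 2) with (k ^ 6 * (z ^ 6 / 4)) by (unfold ka; field).
    apply Rmult_le_compat_r; [assert (0 <= z ^ 6) by (apply pow_le; lra); lra|].
    assert (1 <= k ^ 5) by (apply pow_R1_Rle; lra).
    replace (k ^ 6) with (k * k ^ 5) by ring. nra.
  - assert (Hv2 : 3 / 8 * l * (u ^ 2 * y) <= v).
    { assert (3 / 4 * l * (u ^ 2 * (y / 2)) <= 3 / 4 * l * (u ^ 2 * (y - t))).
      { apply Rmult_le_compat_l; [lra|]. apply Rmult_le_compat_l; lra. }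
      lra. }
    assert (Huy : 0 <= u ^ 2 * y) by (apply Rmult_le_pos; lra).
    assert (S1 : q1 y ^ 2 <= (3 * (u ^ 2 * y)) ^ 2) by (apply pow_incr; lra).
    assert (S2 : (3 / 8 * l * (u ^ 2 * y)) ^ 2 <= v ^ 2).
    { apply pow_incr. split; [|exact Hv2]. apply Rmult_le_pos; lra. }
    assert (S3 : k * (3 / 8 * l * (u ^ 2 * y)) ^ 2 <= ka * v ^ 2).
    { apply Rmult_le_compat; [lra|apply pow2_ge_0|lra|exact S2]. }
    assert (S4 : 4 * K1 * q1 y ^ 2 <= 4 * K1 * (3 * (u ^ 2 * y)) ^ 2)
      by (apply Rmult_le_compat_l; lra).
    eapply Rle_trans; [exact S4|]. eapply Rle_trans; [|exact S3].
    replace (4 * K1 * (3 * (u ^ 2 * y)) ^ 2) with (9 / 64 * (256 * K1) * (u ^ 2 * y) ^ 2) by field.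
    replace (k * (3 / 8 * l * (u ^ 2 * y)) ^ 2) with (9 / 64 * (k * l ^ 2) * (u ^ 2 * y) ^ 2) by field.
    apply Rmult_le_compat_r; [apply pow2_ge_0|lra].
Qed.

(** [J / sqrt (q + ka) = p (C + q A) - p' B + p'' / 2 A] for the approximate WKB amplitude
    [p = (q + ka) ^ (- 1 / 2)], where ['] is [y (1 - y) d/dy]; its ['] is
    [(p''' / 2 + 2 q p' + q' p) A], and [2 q p' + q' p = ka q' (q + ka) ^ (- 3 / 2)]
    dominates [p''' / 2] once [ka] is of the order [z ^ 2] of the Airy scale. *)
Let J (y : R) := C y + q1 y / (2 * (q y + ka)) * B y
  + (q y + 3 / 8 * (q1 y / (q y + ka)) ^ 2 - q2 y / (4 * (q y + ka))) * A y.

Lemma is_derive_J (y : R) :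
  0 < y < 1 -> 0 < q y + ka ->
  is_derive (fun x => J x / sqrt (q x + ka)) y
    ((- (15 / 16) * q1 y ^ 3 + 9 / 8 * q1 y * q2 y * (q y + ka) - / 4 * q3 y * (q y + ka) ^ 2
      + ka * q1 y * (q y + ka) ^ 2)
     * A y / ((q y + ka) ^ 3 * (y * (1 - y))) / sqrt (q y + ka)).
Proof.
  intros Hy Hv.
  pose proof (osc_A _ _ _ _ _ _ HT y Hy) as HA.
  pose proof (osc_B _ _ _ _ _ _ HT y Hy) as HB.
  pose proof (osc_C _ _ _ _ _ _ HT y Hy) as HC.
  pose proof (is_derive_qpot u t b y) as Hq. fold q dq in HA, HB, HC, Hq.
  assert (Hdq : is_derive dq y (- 2 * U)).
  { unfold dq, dqpot, U. auto_derive; [easy|]. field. }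
  eapply is_derive_div_sqrt with (dg := dq y); [| |exact Hv|].
  - unfold J, q1, q2. auto_derive.
    + repeat split; try (eexists; eassumption); lra.
    + replace (Derive (fun x => A x) y) with (2 * B y / (y * (1 - y)))
        by (symmetry; apply is_derive_unique, HA).
      replace (Derive (fun x => B x) y) with ((C y - q y * A y) / (y * (1 - y)))
        by (symmetry; apply is_derive_unique, HB).
      replace (Derive (fun x => C x) y) with (- 2 * q y * B y / (y * (1 - y)))
        by (symmetry; apply is_derive_unique, HC).
      replace (Derive (fun x => q x) y) with (dq y)
        by (symmetry; apply is_derive_unique, Hq).
      replace (Derive (fun x => dq x) y) with (- 2 * U)
        by (symmetry; apply is_derive_unique, Hdq).
      reflexivity.
  - evar_last; [apply (@is_derive_plus _ R_NormedModule _ (fun _ => ka)); [exact Hq|apply @is_derive_const]|].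
    apply Rplus_0_r.
  - f_equal. unfold J, q1, q2, q3. field. lra.
Qed.

Lemma J_div_sqrt_mono (x y : R) :
  t <= x -> x <= y -> y <= t + l / 4 -> J x / sqrt (q x + ka) <= J y / sqrt (q y + ka).
Proof.
  intros Hx Hxy Hy. pose proof regime_k as Hk.
  assert (HH : forall w, t <= w <= t + l / 4 -> 0 < w < 1 /\ 0 < q w + ka).
  { intros w Hw. destruct (shifted_qpot_ge w Hw) as [Hv _]. destruct HR.
    assert (0 <= 3 / 4 * l * (u ^ 2 * (w - t))).
    { apply Rmult_le_pos; [lra|]. apply Rmult_le_pos; [apply pow2_ge_0|lra]. }
    split; lra. }
  eapply (le_of_derive_ge0 (fun w => J w / sqrt (q w + ka))); [exact Hxy| | |].
  - intros w Hw. destruct (HH w ltac:(lra)). apply is_derive_J; auto.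
  - intros w Hw. destruct (HH w ltac:(lra)). apply continuity_pt_of_ex_derive.
    eexists. apply is_derive_J; auto.
  - intros w Hw. assert (Hw' : t <= w <= t + l / 4) by lra.
    destruct (HH w Hw') as [Hw1 Hv].
    pose proof (slope_le_shifted_qpot w Hw') as Hs.
    destruct (shifted_qpot_ge w Hw') as [_ Hr].
    pose proof (dqpot_bounds w Hw') as Hd. pose proof regime_u as Hru.
    apply Rdiv_le_0_compat; [|apply sqrt_lt_R0, Hv].
    apply Rdiv_le_0_compat; [|apply Rmult_lt_0_compat; [apply pow_lt, Hv|lra]].
    apply Rmult_le_pos; [|apply (osc_A_ge0 _ _ _ _ _ _ HT); lra].
    destruct HR.
    apply (monotonicity_numerator_ge0 l K1 ka (w * (1 - w)) (1 - 2 * w) (dq w) U (q w + ka));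
      try lra; try reflexivity.
    + unfold U. lra.
    + unfold U. assert (0 <= / 4 * l) by lra. lra.
    + exact Hs.
Qed.

Lemma le_qpot_off_transition (y : R) :
  t + 4 * ka / (l * u ^ 2) <= y <= t + l / 4 -> t <= y /\ ka <= q y.
Proof.
  intros Hy. pose proof regime_k as Hk. pose proof regime_u as Hu. destruct HR.
  assert (Hlu : 0 < l * u ^ 2) by (apply Rmult_lt_0_compat; lra).
  assert (0 < 4 * ka / (l * u ^ 2)) by (apply Rdiv_lt_0_compat; lra).
  assert (H1 : l * u ^ 2 * (4 * ka / (l * u ^ 2)) <= l * u ^ 2 * (y - t))
    by (apply Rmult_le_compat_l; lra).
  replace (l * u ^ 2 * (4 * ka / (l * u ^ 2))) with (4 * ka) in H1 by (field; lra).
  split; [lra|].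
  destruct (shifted_qpot_ge y ltac:(lra)) as [Hv _].
  lra.
Qed.

Let KE := 6 / l * exp (48 / (e * l)).
Let M0 := 8 * KE / l.

Lemma regime_KE : 0 < KE /\ 0 < M0.
Proof.
  destruct HR.
  assert (0 < KE) by (apply Rmult_lt_0_compat; [apply Rdiv_lt_0_compat; lra|apply exp_pos]).
  split; [assumption|]. apply Rdiv_lt_0_compat; lra.
Qed.

(** [J / sqrt (q + ka)] is nondecreasing, so its value at [t + l / 4] controls everything to the
    left. There [J] is [O(u)] by [energy_le] and [sqrt (q + ka) >= l * u / 4], so [u] cancels and
    leaves [M0]. *)
Lemma amplitude_le (y : R) :
  t + 4 * ka / (l * u ^ 2) <= y <= t + l / 4 ->
  C y / 2 + (q y + ka) / 4 * A y <= M0 * sqrt (q y + ka).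
Proof.
  intros Hy. pose proof regime_k as Hk. pose proof regime_u as Hu. pose proof regime_KE as HKE.
  assert (HJ : forall w, t + 4 * ka / (l * u ^ 2) <= w <= t + l / 4 ->
    C w / 2 + (q w + ka) / 4 * A w <= J w <= 2 * (C w + q w * A w)).
  { intros w Hw. destruct (le_qpot_off_transition w Hw) as [Htw Hq].
    assert (Hw' : t <= w <= t + l / 4) by lra.
    destruct (shifted_qpot_ge w Hw') as [_ Hr].
    pose proof (dqpot_bounds w Hw') as Hd.
    pose proof (slope_le_shifted_qpot w Hw') as Hs.
    destruct HR.
    assert (0 <= l / 4 * u ^ 2) by (apply Rmult_le_pos; lra).
    apply (amplitude_bounds (A w) (B w) (C w) K1 ka (q w) (q1 w) (q2 w)); try lra.
    - apply (osc_A_ge0 _ _ _ _ _ _ HT); lra.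
    - apply (osc_C_ge0 _ _ _ _ _ _ HT); lra.
    - apply (osc_disc _ _ _ _ _ _ HT).
    - apply Rmult_le_pos; lra.
    - apply (monotonicity_numerator_ge0 l K1 ka (w * (1 - w)) (1 - 2 * w) (dq w) U (q w + ka));
        try lra; try reflexivity.
      + unfold U. lra.
      + unfold U. assert (0 <= / 4 * l) by lra. lra.
        + exact Hs. }
  destruct (le_qpot_off_transition y Hy) as [Hty Hq].
  assert (Hv : 0 < q y + ka) by lra.
  pose proof (sqrt_lt_R0 _ Hv) as Hsv.
  apply Rle_trans with (J y); [apply HJ, Hy|].
  apply Rle_div_l; [exact Hsv|].
  eapply Rle_trans; [apply (J_div_sqrt_mono y (t + l / 4)); lra|].
  set (y0 := t + l / 4) in *.
  assert (Hy0 : t + 4 * ka / (l * u ^ 2) <= y0 <= y0) by lra.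
  destruct (HJ y0 Hy0) as [_ HJ0].
  destruct (le_qpot_off_transition y0 Hy0) as [_ Hq0].
  assert (HE : C y0 + q y0 * A y0 <= KE * u).
  { destruct HR. apply (energy_le u t b A B C HT reg_u0 l e reg_l0 reg_e0 reg_t0 reg_ub0).
    unfold y0. lra. }
  assert (Hsq : l * u / 4 <= sqrt (q y0 + ka)).
  { destruct HR. rewrite <- (sqrt_pow2 (l * u / 4)).
    - apply sqrt_le_1_alt.
      destruct (shifted_qpot_ge y0 ltac:(unfold y0; lra)) as [Hv0 _].
      unfold y0 in Hv0 at 1. replace (t + l / 4 - t) with (l / 4) in Hv0 by ring.
      assert (0 <= l ^ 2 * u ^ 2) by (apply Rmult_le_pos; apply pow2_ge_0).
      replace ((l * u / 4) ^ 2) with (l ^ 2 * u ^ 2 / 16) by field. lra.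
    - apply Rdiv_le_0_compat; [apply Rmult_le_pos; lra|lra]. }
  apply Rle_div_l; [apply sqrt_lt_R0; lra|].
  assert (M0 * (l * u / 4) <= M0 * sqrt (q y0 + ka)) by (apply Rmult_le_compat_l; lra).
  replace (M0 * (l * u / 4)) with (2 * (KE * u)) in H by (unfold M0; field; destruct HR; lra).
  lra.
Qed.

Lemma osc_A_right (y : R) :
  t + 4 * ka / (l * u ^ 2) <= y <= t + l / 4 ->
  A y * sqrt (z ^ 2 + 2 * u ^ 2 * (y - t)) <= 16 / l * M0.
Proof.
  intros Hy. pose proof (amplitude_le y Hy) as HA.
  destruct (le_qpot_off_transition y Hy) as [Hty Hq].
  destruct (shifted_qpot_ge y ltac:(lra)) as [Hv _].
  pose proof regime_k as Hk. pose proof regime_KE as HKE. pose proof regime_u as Hu.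
  destruct HR.
  pose proof (osc_A_ge0 _ _ _ _ _ _ HT y ltac:(lra)) as HA0.
  pose proof (osc_C_ge0 _ _ _ _ _ _ HT y ltac:(lra)) as HC0.
  set (v := q y + ka) in *.
  assert (Hvp : 0 < v) by (unfold v; lra).
  pose proof (sqrt_lt_R0 v Hvp) as Hs. pose proof (sqrt_sqrt v ltac:(lra)) as Hss.
  assert (Hz2 : 0 <= z ^ 2) by apply pow2_ge_0.
  assert (Hzka : z ^ 2 <= ka).
  { unfold ka. assert (1 * z ^ 2 <= k ^ 2 * z ^ 2) by (apply Rmult_le_compat_r; nra). lra. }
  assert (Hw : sqrt (z ^ 2 + 2 * u ^ 2 * (y - t)) <= 4 / l * sqrt v).
  { assert (H4l : 4 <= 4 / l) by (apply le_div_unit; lra).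
    rewrite <- (sqrt_pow2 (4 / l)) by lra. rewrite <- sqrt_mult by (try apply pow2_ge_0; lra).
    apply sqrt_le_1_alt.
    assert (0 <= u ^ 2 * (y - t)) by (apply Rmult_le_pos; lra).
    apply Rle_trans with (4 / l * v).
    - assert (4 / l * (3 / 4 * l * (u ^ 2 * (y - t)) + ka / 2) <= 4 / l * v)
        by (apply Rmult_le_compat_l; lra).
      replace (4 / l * (3 / 4 * l * (u ^ 2 * (y - t)) + ka / 2))
        with (3 * (u ^ 2 * (y - t)) + 4 / l * (ka / 2)) in H0 by (field; lra).
      assert (4 * (ka / 2) <= 4 / l * (ka / 2)) by (apply Rmult_le_compat_r; lra).
      lra.
    - apply Rmult_le_compat_r; [lra|]. nra. }
  assert (HAs : A y * sqrt v <= 4 * M0).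
  { apply (Rmult_le_reg_r (sqrt v)); [exact Hs|]. rewrite Rmult_assoc, Hss. lra. }
  apply Rle_trans with (A y * (4 / l * sqrt v)); [apply Rmult_le_compat_l; lra|].
  assert (4 / l * (A y * sqrt v) <= 4 / l * (4 * M0)).
  { apply Rmult_le_compat_l; [apply Rdiv_le_0_compat; lra|lra]. }
  replace (16 / l * M0) with (4 / l * (4 * M0)) by (field; lra). lra.
Qed.

Lemma osc_A_far (y : R) :
  t + l / 4 <= y <= 1 - e -> A y * sqrt (z ^ 2 + 2 * u ^ 2 * (y - t)) <= 32 * KE / (e * l).
Proof.
  intros Hy. pose proof regime_k as Hk. pose proof regime_KE as HKE. pose proof regime_u as Hu.
  destruct HR.
  destruct (energy_le u t b A B C HT reg_u0 l e reg_l0 reg_e0 reg_t0 reg_ub0 y ltac:(lra))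
    as [Hq HE]. fold q KE in Hq, HE.
  pose proof (osc_A_ge0 _ _ _ _ _ _ HT y ltac:(lra)) as HA0.
  pose proof (osc_C_ge0 _ _ _ _ _ _ HT y ltac:(lra)) as HC0.
  assert (Hel : 0 < e * l) by (apply Rmult_lt_0_compat; lra).
  assert (Hzka : z ^ 2 <= ka).
  { unfold ka. assert (1 * z ^ 2 <= k ^ 2 * z ^ 2) by (apply Rmult_le_compat_r; nra). lra. }
  assert (Hw : sqrt (z ^ 2 + 2 * u ^ 2 * (y - t)) <= 2 * u).
  { rewrite <- (sqrt_pow2 (2 * u)) by lra. apply sqrt_le_1_alt.
    assert (u ^ 2 * (y - t) <= u ^ 2 * 1) by (apply Rmult_le_compat_l; lra). lra. }
  assert (HA : A y * u <= 16 * KE / (e * l)).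
  { apply (proj1 (Rle_div_r (A y * u) (16 * KE) (e * l) Hel)). apply (Rmult_le_reg_r u); [lra|].
    assert (e * l / 16 * u ^ 2 * A y <= q y * A y) by (apply Rmult_le_compat_r; lra). lra. }
  apply Rle_trans with (A y * (2 * u)); [apply Rmult_le_compat_l; lra|].
  replace (32 * KE / (e * l)) with (2 * (16 * KE / (e * l))) by (field; lra). lra.
Qed.

Let X := exp (128 * k ^ 3 / l ^ 3).

(** Here [q] may be small, so the energy is replaced by [C + ka * A], which is at least
    [2 * k * z * |B|]. It is carried leftwards from the edge [y1] of the zone, where [amplitude_le]
    applies. *)
Lemma osc_A_transition (y : R) :
  t <= y <= t + 4 * ka / (l * u ^ 2) -> A y * (k * z) <= 30 / l * M0 * X.
Proof.
  intros Hy. pose proof regime_k as Hk. pose proof regime_KE as HKE. pose proof regime_u as Hu.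
  destruct HR. set (y1 := t + 4 * ka / (l * u ^ 2)) in *.
  assert (Hlu : 0 < l * u ^ 2) by (apply Rmult_lt_0_compat; lra).
  assert (Hy1 : t < y1 <= t + l / 4).
  { unfold y1. split.
    - assert (0 < 4 * ka / (l * u ^ 2)) by (apply Rdiv_lt_0_compat; lra). lra.
    - apply Rplus_le_compat_l. apply Rle_div_l; [lra|]. lra. }
  assert (Hdy : forall w, w <= y1 -> u ^ 2 * (w - t) <= 4 * ka / l).
  { intros w Hw. assert (u ^ 2 * (w - t) <= u ^ 2 * (4 * ka / (l * u ^ 2)))
      by (apply Rmult_le_compat_l; unfold y1 in Hw; lra).
    replace (u ^ 2 * (4 * ka / (l * u ^ 2))) with (4 * ka / l) in H by (field; lra). exact H. }
  assert (Hkz : 1 <= k * z) by nra.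
  assert (Hkal : ka <= ka / l) by (apply le_div_unit; lra).
  set (L := 8 * (k * z) / (l ^ 2 * t)).
  assert (HL0 : 0 < L).
  { apply Rdiv_lt_0_compat; [lra|]. apply Rmult_lt_0_compat; [apply pow_lt|]; lra. }
  assert (HM : C y + ka * A y <= (C y1 + ka * A y1) * exp (L * (y1 - y))).
  { apply (gronwall_two_sided L (fun w => C w + ka * A w)
      (fun w => 2 * (ka - q w) * B w / (w * (1 - w))) y y1); [lra| | |].
    - intros w Hw.
      pose proof (osc_C _ _ _ _ _ _ HT w ltac:(lra)) as H1.
      pose proof (osc_A _ _ _ _ _ _ HT w ltac:(lra)) as H2.
      evar_last.
      + apply (@is_derive_plus _ R_NormedModule); [exact H1|].
        apply (is_derive_scal A); exact H2.
      + unfold plus; simpl. eqR. fold q. field. lra.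
    - intros w _. apply continuity_pt_plus; [apply (osc_C_cont _ _ _ _ _ _ HT)|].
      apply continuity_pt_mult; [apply continuity_pt_const; intros ? ?; reflexivity
                                |apply (osc_A_cont _ _ _ _ _ _ HT)].
    - intros w Hw.
      pose proof (osc_A_ge0 _ _ _ _ _ _ HT w ltac:(lra)) as HA0.
      pose proof (osc_C_ge0 _ _ _ _ _ _ HT w ltac:(lra)) as HC0.
      pose proof (osc_disc _ _ _ _ _ _ HT w) as HD.
      specialize (Hdy w ltac:(lra)).
      assert (Hwt : 0 <= u ^ 2 * (w - t)) by (apply Rmult_le_pos; lra).
      assert (Hq : Rabs (ka - q w) <= 6 * (ka / l)).
      { apply Rabs_le.
        pose proof (qpot_le u t b w ltac:(lra)) as Hq1. fold q in Hq1.
        destruct (shifted_qpot_ge w ltac:(lra)) as [Hq2 _].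
        assert (0 <= 3 / 4 * l * (u ^ 2 * (w - t))) by (apply Rmult_le_pos; lra).
        assert ((1 - w) * (u ^ 2 * (w - t)) <= 1 * (u ^ 2 * (w - t)))
          by (apply Rmult_le_compat_r; lra).
        lra. }
      assert (HB : 2 * (k * z) * Rabs (B w) <= C w + ka * A w).
      { rewrite <- (Rabs_pos_eq (2 * (k * z))) by lra. rewrite <- Rabs_mult.
        assert (0 <= ka * A w) by (apply Rmult_le_pos; lra).
        rewrite <- (Rabs_pos_eq (C w + ka * A w)) by lra.
        apply Rsqr_le_abs_0. unfold Rsqr.
        replace (2 * (k * z) * B w * (2 * (k * z) * B w)) with (4 * ka * (A w * C w))
          by (rewrite <- HD; unfold ka; ring).
        pose proof (pow2_ge_0 (C w - ka * A w)). nra. }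
      assert (Hr : 3 / 4 * l * t <= w * (1 - w)).
      { replace (3 / 4 * l * t) with (t * (3 / 4 * l)) by ring. apply Rmult_le_compat; lra. }
      assert (Hlt : 0 < 3 / 4 * l * t) by (apply Rmult_lt_0_compat; lra).
      unfold Rdiv. rewrite !Rabs_mult, (Rabs_pos_eq 2) by lra.
      rewrite (Rabs_pos_eq (/ (w * (1 - w)))) by (left; apply Rinv_0_lt_compat; lra).
      pose proof (Rabs_pos (B w)) as HBp.
      apply Rle_trans with (2 * (6 * (ka / l)) * Rabs (B w) * / (3 / 4 * l * t)).
      + apply Rmult_le_compat.
        * apply Rmult_le_pos; [|exact HBp]. pose proof (Rabs_pos (ka - q w)). lra.
        * left; apply Rinv_0_lt_compat; lra.
        * apply Rmult_le_compat_r; lra.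
        * apply Rinv_le_contravar; lra.
      + replace (2 * (6 * (ka / l)) * Rabs (B w) * / (3 / 4 * l * t))
          with (L * (2 * (k * z) * Rabs (B w))) by (unfold L, ka; field; lra).
        apply Rmult_le_compat_l; lra. }
  (* Rate times length is [32 k ^ 3 z ^ 3 / (l ^ 3 u ^ 2 t)], and [z ^ 3 = 4 u ^ 2 t] removes every
     large parameter. *)
  assert (HX : exp (L * (y1 - y)) <= X).
  { assert (H : L * (y1 - y) <= 128 * k ^ 3 / l ^ 3).
    { apply Rle_trans with (L * (y1 - t)); [apply Rmult_le_compat_l; lra|].
      right. unfold L, y1, ka.
      transitivity (32 * k ^ 3 * z ^ 3 / (l ^ 3 * u ^ 2 * t)); [field; lra|].
      rewrite reg_zt0. field. lra. }
    destruct (Rle_lt_or_eq_dec _ _ H) as [h|h]; [left; apply exp_increasing, h|].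
    unfold X. rewrite h. lra. }
  assert (Hy1' : t + 4 * ka / (l * u ^ 2) <= y1 <= t + l / 4) by (fold y1; lra).
  pose proof (amplitude_le y1 Hy1') as HA1.
  destruct (le_qpot_off_transition y1 Hy1') as [_ Hq1].
  pose proof (osc_A_ge0 _ _ _ _ _ _ HT y1 ltac:(lra)) as HA10.
  pose proof (osc_C_ge0 _ _ _ _ _ _ HT y1 ltac:(lra)) as HC10.
  pose proof (osc_C_ge0 _ _ _ _ _ _ HT y ltac:(lra)) as HC0.
  assert (Hsv : sqrt (q y1 + ka) <= 5 / l * (k * z)).
  { assert (H5 : 5 <= 5 / l) by (apply le_div_unit; lra).
    rewrite <- (sqrt_pow2 (5 / l * (k * z))) by (apply Rmult_le_pos; lra).
    apply sqrt_le_1_alt.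
    replace ((5 / l * (k * z)) ^ 2) with (5 / l * (5 / l) * ka) by (unfold ka; field; lra).
    apply Rle_trans with (5 / l * ka).
    - pose proof (qpot_le u t b y1 ltac:(lra)) as Hq2. fold q in Hq2.
      specialize (Hdy y1 ltac:(lra)).
      assert (0 <= u ^ 2 * (y1 - t)) by (apply Rmult_le_pos; lra).
      assert ((1 - y1) * (u ^ 2 * (y1 - t)) <= 1 * (u ^ 2 * (y1 - t)))
        by (apply Rmult_le_compat_r; lra).
      replace (5 / l * ka) with (4 * ka / l + ka / l) by (field; lra). lra.
    - apply Rmult_le_compat_r; [lra|]. nra. }
  assert (HM1 : C y1 + ka * A y1 <= 30 / l * M0 * (k * z)).
  { assert (0 <= ka * A y1) by (apply Rmult_le_pos; lra).
    assert (ka * A y1 <= (q y1 + ka) * A y1) by (apply Rmult_le_compat_r; lra).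
    assert (M0 * sqrt (q y1 + ka) <= M0 * (5 / l * (k * z))) by (apply Rmult_le_compat_l; lra).
    replace (30 / l * M0 * (k * z)) with (6 * (M0 * (5 / l * (k * z)))) by (field; lra).
    lra. }
  apply (Rmult_le_reg_r (k * z)); [lra|].
  replace (A y * (k * z) * (k * z)) with (ka * A y) by (unfold ka; ring).
  apply Rle_trans with (C y + ka * A y); [lra|].
  eapply Rle_trans; [exact HM|].
  replace (30 / l * M0 * X * (k * z)) with (30 / l * M0 * (k * z) * X) by ring.
  apply Rmult_le_compat; [|left; apply exp_pos|exact HM1|exact HX].
  assert (0 <= ka * A y1) by (apply Rmult_le_pos; lra). lra.
Qed.

(** One summand for each of [osc_A_right], [osc_A_far] and the transition zone; the last also covers
    [y <= t]. Only [l], [e] and [k] enter, which gives the uniformity. The [270] is [30] from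
    [osc_A_transition] times [9] from the weight there. *)
Definition osc_const : R :=
  16 / l * M0 + 32 * KE / (e * l) + 270 / l ^ 2 * M0 * X.

Lemma osc_A_le (y : R) :
  0 <= y <= 1 - e ->
  A y * sqrt (z ^ 2 + 2 * u ^ 2 * Rabs (y - t)) <= osc_const.
Proof.
  intros Hy. pose proof regime_k as Hk. pose proof regime_KE as HKE. pose proof regime_u as Hu.
  assert (HX : 0 < X) by apply exp_pos.
  assert (H0 : 0 <= 16 / l * M0 /\ 0 <= 32 * KE / (e * l) /\ 0 <= 270 / l ^ 2 * M0 * X /\
     2 * (30 / l * M0 * X) <= 270 / l ^ 2 * M0 * X /\ 1 <= / l).
  { destruct HR.
    assert (Hi : 1 <= / l) by (rewrite <- Rinv_1; apply Rinv_le_contravar; lra).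
    assert (0 <= / l * M0 * X) by (apply Rmult_le_pos; [apply Rmult_le_pos|]; lra).
    assert (1 * (/ l * M0 * X) <= / l * (/ l * M0 * X)) by (apply Rmult_le_compat_r; lra).
    replace (270 / l ^ 2 * M0 * X) with (270 * (/ l * (/ l * M0 * X))) by (field; lra).
    replace (30 / l * M0 * X) with (30 * (/ l * M0 * X)) by (field; lra).
    repeat split; try lra.
    - apply Rmult_le_pos; [apply Rdiv_le_0_compat|]; lra.
    - apply Rdiv_le_0_compat; [lra|]. apply Rmult_lt_0_compat; lra. }
  assert (Hkz : 1 <= k * z /\ z <= k * z) by (destruct HR; nra).
  unfold osc_const.
  destruct (Rle_dec y t) as [Hyt|Hyt].
  - rewrite Rabs_left1 by lra. replace (- (y - t)) with (t - y) by ring.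
    assert (HAt : A t * (k * z) <= 30 / l * M0 * X).
    { apply osc_A_transition. destruct HR. split; [lra|].
      assert (0 <= 4 * ka / (l * u ^ 2)).
      { apply Rdiv_le_0_compat; [lra|]. apply Rmult_lt_0_compat; lra. }
      lra. }
    eapply Rle_trans.
    { pose proof regime_b as Hb. destruct HR. apply (osc_A_left u t b A B C HT); lra. }
    assert (A t * z <= A t * (k * z)).
    { apply Rmult_le_compat_l; [|lra]. destruct HR. apply (osc_A_ge0 _ _ _ _ _ _ HT). lra. }
    lra.
  - rewrite Rabs_pos_eq by lra.
    destruct (Rle_dec y (t + 4 * ka / (l * u ^ 2))) as [Hy1|Hy1].
    + pose proof (osc_A_transition y ltac:(lra)) as HA.
      assert (Hs : sqrt (z ^ 2 + 2 * u ^ 2 * (y - t)) <= 9 / l * (k * z)).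
      { destruct HR. 
        assert (Hzka : z ^ 2 <= ka).
        { unfold ka. assert (1 * z ^ 2 <= k ^ 2 * z ^ 2) by (apply Rmult_le_compat_r; nra). lra. }
        rewrite <- (sqrt_pow2 (9 / l * (k * z))) by (apply Rmult_le_pos; unfold Rdiv; lra).
        apply sqrt_le_1_alt.
        replace ((9 / l * (k * z)) ^ 2) with (81 * (/ l * (/ l * ka))) by (unfold ka; field; lra).
        assert (u ^ 2 * (y - t) <= u ^ 2 * (4 * ka / (l * u ^ 2)))
          by (apply Rmult_le_compat_l; lra).
        replace (u ^ 2 * (4 * ka / (l * u ^ 2))) with (4 * (/ l * ka)) in H by (field; lra).
        assert (1 * ka <= / l * ka) by (apply Rmult_le_compat_r; lra).
        assert (1 * (/ l * ka) <= / l * (/ l * ka)) by (apply Rmult_le_compat_r; lra).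
        lra. }
      assert (A y * sqrt (z ^ 2 + 2 * u ^ 2 * (y - t)) <= A y * (9 / l * (k * z))).
      { apply Rmult_le_compat_l; [|exact Hs]. destruct HR. apply (osc_A_ge0 _ _ _ _ _ _ HT). lra. }
      assert (9 / l * (A y * (k * z)) <= 9 / l * (30 / l * M0 * X)).
      { apply Rmult_le_compat_l; [unfold Rdiv; lra|exact HA]. }
      replace (270 / l ^ 2 * M0 * X) with (9 / l * (30 / l * M0 * X)) by (field; destruct HR; lra).
      lra.
    + destruct (Rle_dec y (t + l / 4)) as [Hy2|Hy2].
      * pose proof (osc_A_right y ltac:(lra)). lra.
      * pose proof (osc_A_far y ltac:(lra)). lra.
Qed.

End Transition.

(** * Choice of the parameters, bounded [u], and the final estimate *)

Lemma Rpower_two_thirds_cube (a : R) : 0 < a -> Rpower a (2 / 3) ^ 3 = a ^ 2.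
Proof.
  intros Ha. rewrite <- Rpower_pow by apply exp_pos. rewrite Rpower_mult.
  rewrite <- Rpower_pow by exact Ha. f_equal. simpl. field.
Qed.

Lemma osc_regime_of_large (l e k u b a : R) :
  0 < l < 1 -> 0 < e <= l / 4 -> 300 * (1 + 6 / l) / l ^ 2 <= k -> b ^ 2 + 1 <= k ->
  (1 + 6 / l) ^ 2 <= k -> 1 <= a -> a ^ 2 <= 4 * u ^ 2 * (1 - l) -> 1 <= u ->
  4 * (b ^ 2 + 1) <= e * l ^ 2 * u ^ 2 -> 65536 * k ^ 6 <= l ^ 6 * u ^ 2 ->
  osc_regime l e k u (a ^ 2 / (4 * u ^ 2)) b (Rpower a (2 / 3)).
Proof.
  intros Hl He Hk1 Hk2 Hk3 Ha Hal Hu Hub Huk.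
  assert (Hu2 : 1 <= u ^ 2) by nra.
  assert (Ha2 : 1 <= a ^ 2) by nra.
  set (z := Rpower a (2 / 3)).
  assert (Hz3 : z ^ 3 = a ^ 2) by (apply Rpower_two_thirds_cube; lra).
  assert (Hz : 1 <= z).
  { unfold z. rewrite <- (Rpower_O a) by lra. apply Rle_Rpower; lra. }
  constructor; auto.
  - split; [apply Rdiv_lt_0_compat; lra|]. apply Rle_div_l; lra.
  - rewrite Hz3. field. lra.
  - apply Rnot_lt_le. intros H.
    assert (Hlu : 0 <= l ^ 2 * u ^ 2) by (apply Rmult_le_pos; apply pow2_ge_0).
    (* Cubing turns [z] into [z ^ 3 = a ^ 2 <= 4 u ^ 2]; this is the origin of
       [65536 = 16 ^ 3 * 4 ^ 2]. *)
    assert (H3 : (l ^ 2 * u ^ 2) ^ 3 < (16 * (k ^ 2 * z ^ 2)) ^ 3).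
    { set (p := l ^ 2 * u ^ 2) in *. set (s := 16 * (k ^ 2 * z ^ 2)) in *.
      assert (0 < (s - p) * (s ^ 2 + s * p + p ^ 2)) by (apply Rmult_lt_0_compat; nra). lra. }
    replace ((l ^ 2 * u ^ 2) ^ 3) with (l ^ 6 * u ^ 2 * u ^ 4) in H3 by ring.
    replace ((16 * (k ^ 2 * z ^ 2)) ^ 3) with (4096 * k ^ 6 * (z ^ 3) ^ 2) in H3 by ring.
    rewrite Hz3 in H3.
    assert (Hu4 : 0 <= u ^ 4) by (apply pow_le; lra).
    assert (H4 : (a ^ 2) ^ 2 <= (4 * u ^ 2) ^ 2).
    { apply pow_incr. split; [lra|].
      assert (4 * u ^ 2 * (1 - l) <= 4 * u ^ 2 * 1) by (apply Rmult_le_compat_l; lra). lra. }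
    replace ((4 * u ^ 2) ^ 2) with (16 * u ^ 4) in H4 by ring.
    assert (0 <= 4096 * k ^ 6) by (assert (0 <= k ^ 6) by (apply pow_le; pose proof (pow2_ge_0 b); lra); lra).
    assert (4096 * k ^ 6 * (a ^ 2) ^ 2 <= 4096 * k ^ 6 * (16 * u ^ 4))
      by (apply Rmult_le_compat_l; lra).
    assert (65536 * k ^ 6 * u ^ 4 <= l ^ 6 * u ^ 2 * u ^ 4) by (apply Rmult_le_compat_r; lra).
    lra.
Qed.

Lemma sqr_weighted_jacobi (n a b : nat) (x : R) :
  x <= 1 ->
  (jac_weight a x * jacobiP n a b x) ^ 2 * (1 - (1 - x) / 2) ^ b
  = jac_density n a b ((1 - x) / 2).
Proof.
  intros Hx. unfold jac_weight, jac_density. rewrite jacobiP_jac01.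
  set (y := (1 - x) / 2).
  assert (E : (sqrt y ^ a) ^ 2 = y ^ a).
  { rewrite <- pow_mult, Nat.mul_comm, pow_mult, pow2_sqrt; [reflexivity|unfold y; lra]. }
  rewrite Rpow_mult_distr, E. ring.
Qed.

Lemma exists_uniform_bound (f : nat -> nat -> R) (N : nat) :
  exists M, 0 <= M /\ forall n a, (n <= N)%nat -> (a <= N)%nat -> f n a <= M.
Proof.
  assert (H1 : forall (g : nat -> R) (m : nat),
    0 <= sum_f_R0 (fun i => Rabs (g i)) m /\
    forall i, (i <= m)%nat -> g i <= sum_f_R0 (fun i => Rabs (g i)) m).
  { intros g m. induction m as [|m [IH0 IH]]; simpl.
    - split; [apply Rabs_pos|]. intros i Hi. replace i with 0%nat by lia. apply Rle_abs.
    - pose proof (Rabs_pos (g (S m))). split; [lra|]. intros i Hi.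
      destruct (Nat.eq_dec i (S m)) as [->|Hne].
      + pose proof (Rle_abs (g (S m))). lra.
      + specialize (IH i ltac:(lia)). lra. }
  exists (sum_f_R0 (fun i => Rabs (sum_f_R0 (fun j => Rabs (f i j)) N)) N).
  split; [apply (H1 (fun i => sum_f_R0 (fun j => Rabs (f i j)) N))|].
  intros n a Hn Ha.
  eapply Rle_trans; [apply (H1 (f n)), Ha|].
  apply (H1 (fun i => sum_f_R0 (fun j => Rabs (f i j)) N)). exact Hn.
Qed.

Lemma exists_jacobi_bound (b N : nat) :
  exists M, 0 <= M /\ forall n a x, (n <= N)%nat -> (a <= N)%nat -> -1 <= x <= 1 ->
    Rabs (jac_weight a x * jacobiP n a b x) <= M.
Proof.
  destruct (exists_uniform_bound (fun n a =>
    sum_f_R0 (fun s => Rabs (binom (n + a) (n - s) * binom (n + b) s)) n) N) as (M & HM0 & HM).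
  exists M. split; [exact HM0|]. intros n a x Hn Ha Hx.
  assert (Hpow : forall w m, Rabs w <= 1 -> Rabs (w ^ m) <= 1).
  { intros w m Hw. rewrite <- RPow_abs, <- (pow1 m). apply pow_incr.
    split; [apply Rabs_pos|exact Hw]. }
  eapply Rle_trans; [|apply (HM n a Hn Ha)].
  rewrite Rabs_mult, <- (Rmult_1_l (sum_f_R0 _ n)).
  apply Rmult_le_compat; try apply Rabs_pos.
  - apply Hpow. rewrite Rabs_pos_eq by apply sqrt_pos.
    apply Rle_trans with (sqrt 1); [apply sqrt_le_1_alt; lra|rewrite sqrt_1; lra].
  - unfold jacobiP. eapply Rle_trans; [apply Rsum_abs|].
    apply sum_Rle. intros s _.
    rewrite Rabs_mult, (Rabs_mult (binom (n + a) (n - s) * binom (n + b) s)).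
    set (m := binom (n + a) (n - s) * binom (n + b) s).
    apply Rle_trans with (Rabs m * 1 * 1); [|lra].
    pose proof (Rabs_pos m).
    apply Rmult_le_compat; [|apply Rabs_pos| |apply Hpow, Rabs_le; lra].
    + apply Rmult_le_pos; apply Rabs_pos.
    + apply Rmult_le_compat_l; [lra|]. apply Hpow, Rabs_le. lra.
Qed.

Lemma le_of_sqr_le (v w : R) : 0 <= w -> v ^ 2 <= w ^ 2 -> v <= w.
Proof. intros Hw H. apply Rsqr_incr_0_var; [unfold Rsqr; lra|exact Hw]. Qed.

Theorem theorem8p4 (beta : nat) (eps c : R) :
  0 < eps < 2 -> 0 < c ->
  exists Cst : R,
    forall (x : R) (alpha n : nat),
      -1 + eps <= x <= 1 ->
      1 <= INR alpha <= c * (1 + INR n) ->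
      let u := jac_u n alpha beta in
      let xtr := jac_xtr n alpha beta in
      let v := Rabs (jac_weight alpha x * jacobiP n alpha beta x) in
      v <= Cst * Rpower (u ^ 2 * Rabs (x - xtr) + Rpower (INR alpha) (4 / 3)) (- (1 / 4))
      /\ (1 - x <= (1 - xtr) / 16 -> v <= Cst * (/ 2) ^ alpha).
Proof.
  intros Heps Hc.
  (* The hypothesis on [alpha] gives [alpha * (1 + c) <= 2 * u * c], hence
     [t = (alpha / (2 u)) ^ 2 <= g ^ 2 = 1 - l]. *)
  set (g := c / (1 + c)).
  assert (Hg : 0 < g < 1).
  { unfold g. split; [apply Rdiv_lt_0_compat; lra|].
    apply (proj2 (Rlt_div_l c 1 (1 + c) ltac:(lra))). lra. }
  set (l := 1 - g ^ 2).
  assert (Hl : 0 < l < 1) by (unfold l; nra).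
  (* [x >= -1 + eps] means [y <= 1 - eps / 2]. *)
  set (e := Rmin (eps / 2) (l / 4)).
  assert (He : 0 < e <= l / 4).
  { split; [apply Rmin_glb_lt; lra|apply Rmin_r]. }
  assert (Hee : e <= eps / 2) by apply Rmin_l.
  set (b := INR beta).
  set (K1 := 1 + 6 / l).
  assert (HK1 : 0 < K1) by (assert (0 < 6 / l) by (apply Rdiv_lt_0_compat; lra); unfold K1; lra).
  set (k := 300 * K1 / l ^ 2 + (b ^ 2 + 1) + K1 ^ 2).
  assert (Hl2 : 0 < l ^ 2) by (apply pow_lt; lra).
  assert (Hl6 : 0 < l ^ 6) by (apply pow_lt; lra).
  assert (Hb2 : 0 <= b ^ 2) by apply pow2_ge_0.
  assert (HK12 : 0 <= K1 ^ 2) by apply pow2_ge_0.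
  assert (HKl : 0 < 300 * K1 / l ^ 2) by (apply Rdiv_lt_0_compat; lra).
  set (u0 := 1 + 4 * (b ^ 2 + 1) / (e * l ^ 2) + 65536 * k ^ 6 / l ^ 6).
  assert (Hel2 : 0 < e * l ^ 2) by (apply Rmult_lt_0_compat; lra).
  assert (Hu01 : 0 < 4 * (b ^ 2 + 1) / (e * l ^ 2)) by (apply Rdiv_lt_0_compat; lra).
  assert (Hu02 : 0 <= 65536 * k ^ 6 / l ^ 6).
  { apply Rdiv_le_0_compat; [|exact Hl6]. assert (0 <= k ^ 6) by (apply pow_le; unfold k; lra). lra. }
  set (N0 := Z.to_nat (up (2 * u0))).
  assert (HN0 : forall m, INR m <= 2 * u0 -> (m <= N0)%nat).
  { intros m Hm. destruct (archimed (2 * u0)) as [Hup _].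
    apply INR_le. unfold N0. rewrite (INR_IZR_INZ (Z.to_nat _)), Z2Nat.id.
    - lra.
    - apply le_IZR. unfold u0 in *. lra. }
  destruct (exists_jacobi_bound beta N0) as (M & HM0 & HM).
  set (K := osc_const l e k / e ^ beta).
  (* An upper bound, when [u < u0], for the quantity raised to [- 1 / 4]; it uses [z ^ 2 <= (z ^ 3)
     ^ 2 = alpha ^ 4 <= (2 u0) ^ 4]. *)
  set (Xm := 2 * u0 ^ 2 + 16 * u0 ^ 4).
  (* The first summand serves large [u] in both estimates; the other two serve bounded [u], one for
     each estimate. *)
  exists (sqrt K + M * Rpower Xm (1 / 4) + M * 2 ^ N0).
  assert (HXm : 0 < Rpower Xm (1 / 4)) by apply exp_pos.
  assert (H2N : 0 < 2 ^ N0) by (apply pow_lt; lra).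
  assert (HMX : 0 <= M * Rpower Xm (1 / 4)) by (apply Rmult_le_pos; lra).
  assert (HM2 : 0 <= M * 2 ^ N0) by (apply Rmult_le_pos; lra).
  pose proof (sqrt_pos K) as HsK.
  intros x alpha n Hx Hal u xtr v.
  pose proof (pos_INR n) as Hn0. 
  assert (Hb0 : 0 <= b) by apply pos_INR.
  set (a := INR alpha) in *.
  assert (Eu : u = INR n + (a + b + 1) / 2) by reflexivity.
  assert (Hau : a <= 2 * u * g).
  { assert (Hcu : a * (1 + c) <= 2 * u * c) by (rewrite Eu; nra).
    unfold g. replace (2 * u * (c / (1 + c))) with (2 * u * c / (1 + c)) by (field; lra).
    apply (proj1 (Rle_div_r a (2 * u * c) (1 + c) ltac:(lra)) Hcu). }
  assert (Hu1 : 1 <= u) by (rewrite Eu; lra).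
  assert (Hu2 : 1 <= u ^ 2) by nra.
  set (t := a ^ 2 / (4 * u ^ 2)).
  assert (Hal2 : a ^ 2 <= 4 * u ^ 2 * (1 - l)).
  { replace (4 * u ^ 2 * (1 - l)) with ((2 * u * g) ^ 2) by (unfold l; ring).
    apply pow_incr. lra. }
  set (y := (1 - x) / 2).
  assert (Ext : x - xtr = - 2 * (y - t)).
  { unfold xtr, jac_xtr, y, t. fold a u. field. lra. }
  set (z := Rpower a (2 / 3)).
  assert (Ez : Rpower a (4 / 3) = z ^ 2).
  { unfold z. rewrite <- Rpower_pow by apply exp_pos. rewrite Rpower_mult. f_equal. simpl. field. }
  assert (Hz : 1 <= z).
  { unfold z. rewrite <- (Rpower_O a) by lra. apply Rle_Rpower; lra. }
  assert (EX : u ^ 2 * Rabs (x - xtr) + Rpower a (4 / 3) = z ^ 2 + 2 * u ^ 2 * Rabs (y - t)).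
  { rewrite Ext, Ez, Rabs_mult, (Rabs_left1 (-2)) by lra. ring. }
  rewrite EX. set (X := z ^ 2 + 2 * u ^ 2 * Rabs (y - t)).
  assert (Hyt : 0 <= u ^ 2 * Rabs (y - t)) by (apply Rmult_le_pos; [lra|apply Rabs_pos]).
  assert (HX1 : 1 <= X) by (unfold X; nra).
  assert (Htl : 0 < t <= 1 - l).
  { unfold t. split; [apply Rdiv_lt_0_compat; nra|]. apply Rle_div_l; lra. }
  destruct (Rle_dec u0 u) as [Hlarge|Hsmall].
  - assert (Huu : u <= u ^ 2) by nra.
    assert (Hreg : osc_regime l e k u t b z).
    { apply osc_regime_of_large; fold K1; try assumption; try (unfold k; lra); try lra.
      - rewrite <- (Rmult_comm (u ^ 2)). apply Rle_div_l; [lra|]. unfold u0 in Hlarge. lra.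
      - rewrite <- (Rmult_comm (u ^ 2)). apply Rle_div_l; [lra|]. unfold u0 in Hlarge. lra. }
    destruct (jac_osc_triple n alpha beta) as (B & D & HT).
    { apply INR_le. simpl. exact (proj1 Hal). }
    fold u a t b in HT.
    set (A := jac_density n alpha beta) in *.
    assert (Hy : 0 <= y <= 1 - e) by (unfold y; lra).
    assert (Hep : 0 < e ^ beta) by (apply pow_lt; lra).
    assert (Hosc : forall w, 0 <= w <= 1 - e ->
      A w * sqrt (z ^ 2 + 2 * u ^ 2 * Rabs (w - t)) <= osc_const l e k).
    { intros w Hw. apply (osc_A_le l e k u t b z A B D HT Hreg w Hw). }
    assert (HA0 : 0 <= A y) by (apply (osc_A_ge0 _ _ _ _ _ _ HT); lra).
    assert (HAt : A t <= osc_const l e k).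
    { eapply Rle_trans; [|apply (Hosc t); lra].
      rewrite Rminus_diag, Rabs_R0, Rmult_0_r, Rplus_0_r, sqrt_pow2 by lra.
      assert (0 <= A t) by (apply (osc_A_ge0 _ _ _ _ _ _ HT); lra). nra. }
    assert (HAt0 : 0 <= A t) by (apply (osc_A_ge0 _ _ _ _ _ _ HT); lra).
    assert (HK0 : 0 <= K) by (apply Rdiv_le_0_compat; lra).
    (* The factor [(1 - y) ^ beta] is in [A] but not in [v]; it is at least [e ^ beta]. *)
    assert (HvA : v ^ 2 * e ^ beta <= A y).
    { unfold A, y. rewrite <- sqr_weighted_jacobi by lra. unfold v. rewrite pow2_abs.
      apply Rmult_le_compat_l; [apply pow2_ge_0|]. apply pow_incr. fold y. lra. }
    assert (Hv : forall d, A y <= osc_const l e k * d -> v ^ 2 <= K * d).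
    { intros d Hd. apply (Rmult_le_reg_r (e ^ beta)); [exact Hep|].
      replace (K * d * e ^ beta) with (osc_const l e k * d) by (unfold K; field; lra). lra. }
    split.
    + set (p := Rpower X (- (1 / 4))).
      assert (Hp : 0 < p) by apply exp_pos.
      assert (Ep : sqrt X * p ^ 2 = 1).
      { unfold p. rewrite <- Rpower_pow by apply exp_pos. rewrite Rpower_mult.
        rewrite <- Rpower_sqrt by lra. rewrite <- Rpower_plus.
        replace (/ 2 + - (1 / 4) * INR 2) with 0 by (simpl; field).
        apply Rpower_O. lra. }
      assert (Hvp : v <= sqrt K * p).
      { apply le_of_sqr_le; [apply Rmult_le_pos; lra|].
        rewrite Rpow_mult_distr, pow2_sqrt by lra. apply Hv.
        specialize (Hosc y Hy). fold X in Hosc.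
        apply (Rmult_le_compat_r (p ^ 2)) in Hosc; [|apply pow2_ge_0].
        rewrite Rmult_assoc, Ep in Hosc. lra. }
      assert (0 <= (M * Rpower Xm (1 / 4) + M * 2 ^ N0) * p) by (apply Rmult_le_pos; lra).
      lra.
    + intros Hxt.
      set (p := (/ 2) ^ alpha).
      assert (Hp : 0 < p) by (apply pow_lt; lra).
      assert (Ep : (/ 4) ^ alpha = p ^ 2).
      { unfold p. rewrite <- pow_mult, Nat.mul_comm, pow_mult. f_equal. field. }
      assert (Hvp : v <= sqrt K * p).
      { apply le_of_sqr_le; [apply Rmult_le_pos; lra|].
        rewrite Rpow_mult_distr, pow2_sqrt by lra. apply Hv. rewrite <- Ep.
        assert (H4 : 0 < (/ 4) ^ alpha) by (apply pow_lt; lra).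
        (* The decay lemma integrates [1 / y] and needs [y > 0]; at [y = 0] the density vanishes. *)
        destruct (Req_dec y 0) as [Hy0|Hy0].
        - rewrite Hy0, (osc_A0 _ _ _ _ _ _ HT). apply Rmult_le_pos; lra.
        - eapply Rle_trans.
          + apply (osc_A_exp_decay u t b A B D HT ltac:(lra)
              (regime_b l e k u t b z Hreg) alpha y).
            * fold a. unfold t. field. lra.
            * unfold y in *. lra.
          + apply Rmult_le_compat_r; lra. }
      assert (0 <= (M * Rpower Xm (1 / 4) + M * 2 ^ N0) * p) by (apply Rmult_le_pos; lra).
      lra.
  - apply Rnot_le_lt in Hsmall.
    assert (Hn : (n <= N0)%nat) by (apply HN0; rewrite Eu in Hsmall; lra).
    assert (Ha2u : a <= 2 * u0) by (rewrite Eu in Hsmall; lra).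
    assert (Ha : (alpha <= N0)%nat) by (apply HN0; exact Ha2u).
    assert (HvM : v <= M) by (apply HM; [exact Hn|exact Ha|lra]).
    split.
    + assert (HXX : X <= Xm).
      { unfold X, Xm.
        assert (Hz3 : z ^ 3 = a ^ 2) by (apply Rpower_two_thirds_cube; lra).
        assert (z ^ 2 <= 16 * u0 ^ 4).
        { assert (z <= z ^ 3) by (assert (1 <= z ^ 2) by nra; nra).
          apply Rle_trans with ((a ^ 2) ^ 2); [apply pow_incr; lra|].
          replace (16 * u0 ^ 4) with (((2 * u0) ^ 2) ^ 2) by ring.
          apply pow_incr. split; [nra|]. apply pow_incr. lra. }
        assert (Rabs (y - t) <= 1) by (apply Rabs_le; unfold y; lra).
        assert (u ^ 2 * Rabs (y - t) <= u0 ^ 2 * 1).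
        { apply Rmult_le_compat; [lra|apply Rabs_pos| |assumption]. apply pow_incr. lra. }
        lra. }
      assert (Hp : Rpower Xm (- (1 / 4)) <= Rpower X (- (1 / 4))).
      { rewrite !Rpower_Ropp. apply Rinv_le_contravar; [apply exp_pos|].
        apply Rle_Rpower_l; lra. }
      assert (Ep : Rpower Xm (1 / 4) * Rpower Xm (- (1 / 4)) = 1).
      { rewrite Rpower_Ropp. apply Rinv_r. lra. }
      set (p := Rpower X (- (1 / 4))) in *.
      assert (Hp0 : 0 < p) by apply exp_pos.
      assert (M <= M * Rpower Xm (1 / 4) * p).
      { apply Rle_trans with (M * Rpower Xm (1 / 4) * Rpower Xm (- (1 / 4))).
        - rewrite Rmult_assoc, Ep. lra.
        - apply Rmult_le_compat_l; lra. }
      assert (0 <= (sqrt K + M * 2 ^ N0) * p) by (apply Rmult_le_pos; lra).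
      lra.
    + intros _.
      assert (Hp0 : 0 < (/ 2) ^ alpha) by (apply pow_lt; lra).
      assert (M <= M * 2 ^ N0 * (/ 2) ^ alpha).
      { rewrite pow_inv. apply (proj1 (Rle_div_r M (M * 2 ^ N0) (2 ^ alpha) ltac:(apply pow_lt; lra))).
        apply Rmult_le_compat_l; [exact HM0|]. apply Rle_pow; [lra|exact Ha]. }
      assert (0 <= (sqrt K + M * Rpower Xm (1 / 4)) * (/ 2) ^ alpha)
        by (apply Rmult_le_pos; lra).
      lra.
Qed.
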